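(* Fix positive integers $L, d_0, d_L$, a finite dataset $D$ of pairs $(x,y)$ with $x\in\mathbb{R}^{d_0}$ and $y\in Y$ for some set $Y$, nonlinearities $\sigma_1,\dots,\sigma_L$, an error function $e$, a regularization parameter $\lambda>0$, an exponent $1\le p<\infty$, and $\Omega\in\{\Omega_{in},\Omega_{out}\}$, all satisfying the standing assumptions in the context. Then the function $$E(\mathbf{d},\mathbf{W})=\frac{1}{|D|}\sum_{(x,y)\in D} e(f(\mathbf{W},x),y)+\Omega(\mathbf{W},\lambda,p),$$ defined over all pairs $(\mathbf{d},\mathbf{W})$ where $\mathbf{d}=(d_1,\dots,d_{L-1})$ ranges over all tuples of positive integers and $\mathbf{W}=(W_1,\dots,W_L)$ with $W_l\in\mathbb{R}^{d_{l-1}\times d_l}$, attains a global minimum (i.e. there exists $(\mathbf{d}^*,\mathbf{W}^* )$ with $E(\mathbf{d}^*,\mathbf{W}^* )\le E(\mathbf{d},\mathbf{W})$ for all admissible $(\mathbf{d},\mathbf{W})$).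
   Context: Network: for dimensions $d_0,\dots,d_L$ and weights $\mathbf{W}=(W_1,\dots,W_L)$, $W_l\in\mathbb{R}^{d_{l-1}\times d_l}$, define for a row vector $x\in\mathbb{R}^{d_0}$: $x_0=x$, $z_l=x_{l-1}W_l$, $x_l=\sigma_l.(z_l)$ ($\sigma_l$ applied elementwise), $f(\mathbf{W},x)=x_L$. The dimensions $d_0,d_L$ are fixed; $d_1,\dots,d_{L-1}$ vary. Regularizers: $\Omega_{in}(\mathbf{W},\lambda,p)=\lambda\sum_{l=1}^L\sum_{j=1}^{d_l}\|(W_l(1,j),\dots,W_l(d_{l-1},j))\|_p$ (penalizing each column, the fan-in of unit $j$ of layer $l$), and $\Omega_{out}(\mathbf{W},\lambda,p)=\lambda\sum_{l=1}^L\sum_{i=1}^{d_{l-1}}\|(W_l(i,1),\dots,W_l(i,d_l))\|_p$ (penalizing each row). Assumptions on each $\sigma_l:\mathbb{R}\to\mathbb{R}$: (i) there is $b_{1,l}:\mathbb{R}_{\ge0}\to\mathbb{R}_{\ge0}$ with $|\sigma_l(s)|\le b_{1,l}(S)|s|$ for all $S\ge0$, $|s|\le S$; (ii) $\sigma_l$ is left- and right-differentiable everywhere; (iii) there is $b_{2,l}:\mathbb{R}_{\ge0}\to\mathbb{R}_{\ge0}$ such that the left and right derivatives satisfy $|\sigma_l^{\leftarrow}(s)|\le b_{2,l}(S)$ and $|\sigma_l^{\rightarrow}(s)|\le b_{2,l}(S)$ for all $S\ge 0$, $|s|\le S$. Assumptions on $e:\mathbb{R}^{d_L}\times Y\to\mathbb{R}$: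 it is nonnegative everywhere; differentiable in its first argument everywhere; and there is $b_3:\mathbb{R}_{\ge0}\to\mathbb{R}_{\ge0}$ such that for all $S\ge0$, $v\in\mathbb{R}^{d_L}$, $y\in Y$: $e(v,y)\le S$ implies $\|\partial e(v,y)/\partial v\|_\infty\le b_3(S)$. *)

(* Defs.v *)
From Stdlib Require Import Reals Lra List.
Open Scope R_scope.

(* Vectors in R^n are represented as functions nat -> R; only the entries
   with index < n are meaningful.  Matrices of layer l are functions
   nat -> nat -> R (row i, column j), meaningful for i < d(l-1), j < d l. *)

Fixpoint sumR (n : nat) (f : nat -> R) : R :=
  match n with
  | O => 0
  | S k => sumR k f + f k
  end.

Fixpoint supnorm (n : nat) (u : nat -> R) : R :=
  match n with
  | O => 0
  | S k => Rmax (supnorm k u) (Rabs (u k))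
  end.

(* x^a for x >= 0, a > 0 (with 0^a = 0) *)
Definition rpow (x a : R) : R :=
  if Rlt_dec 0 x then Rpower x a else 0.

Definition pnorm (n : nat) (p : R) (v : nat -> R) : R :=
  rpow (sumR n (fun i => rpow (Rabs (v i)) p)) (/ p).

Definition is_vec (n : nat) (v : nat -> R) : Prop :=
  forall i, (n <= i)%nat -> v i = 0.

Definition right_deriv (f : R -> R) (s l : R) : Prop :=
  forall eps, 0 < eps -> exists delta, 0 < delta /\
    forall h, 0 < h < delta -> Rabs ((f (s + h) - f s) / h - l) < eps.

Definition left_deriv (f : R -> R) (s l : R) : Prop :=
  forall eps, 0 < eps -> exists delta, 0 < delta /\
    forall h, - delta < h < 0 -> Rabs ((f (s + h) - f s) / h - l) < eps.

Definition is_grad (n : nat) (F : (nat -> R) -> R) (v g : nat -> R) : Prop :=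
  forall eps, 0 < eps -> exists delta, 0 < delta /\
    forall u, is_vec n u -> supnorm n u < delta ->
      Rabs (F (fun i => v i + u i) - F v - sumR n (fun i => g i * u i))
        <= eps * supnorm n u.

Fixpoint fwd (sigma : nat -> R -> R) (d : nat -> nat)
    (W : nat -> nat -> nat -> R) (x : nat -> R) (l : nat) : nat -> R :=
  match l with
  | O => x
  | S k => fun j => sigma (S k) (sumR (d k) (fun i => fwd sigma d W x k i * W (S k) i j))
  end.

Definition net (L : nat) (sigma : nat -> R -> R) (d : nat -> nat)
    (W : nat -> nat -> nat -> R) (x : nat -> R) : nat -> R :=
  fun j => if Nat.ltb j (d L) then fwd sigma d W x L j else 0.

Definition admissible (L d0 dL : nat) (d : nat -> nat) : Prop :=
  d 0%nat = d0 /\ d L = dL /\ forall l, (0 < l < L)%nat -> (0 < d l)%nat.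

Definition Omega_in (L : nat) (d : nat -> nat) (W : nat -> nat -> nat -> R)
    (lam p : R) : R :=
  lam * sumR L (fun k => sumR (d (S k)) (fun j => pnorm (d k) p (fun i => W (S k) i j))).

Definition Omega_out (L : nat) (d : nat -> nat) (W : nat -> nat -> nat -> R)
    (lam p : R) : R :=
  lam * sumR L (fun k => sumR (d k) (fun i => pnorm (d (S k)) p (fun j => W (S k) i j))).

Definition objective {Y : Type} (L : nat) (D : list ((nat -> R) * Y))
    (sigma : nat -> R -> R) (e : (nat -> R) -> Y -> R)
    (Omega : (nat -> nat) -> (nat -> nat -> nat -> R) -> R)
    (d : nat -> nat) (W : nat -> nat -> nat -> R) : R :=
  / INR (length D) *
    fold_right (fun xy acc => e (net L sigma d W (fst xy)) (snd xy) + acc) 0 D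
  + Omega d W.

(* Main.v *)
Require Import Defs.
From Stdlib Require Import Reals Lra Lia List Arith Classical.
From Stdlib Require Import IndefiniteDescription FunctionalExtensionality.
From Coquelicot Require Import Coquelicot.
Open Scope R_scope.

(** At fixed widths the penalty is coercive and the cost continuous, so a
    minimiser exists; its cost is at most that of the zero weights, which does
    not depend on the widths. Hence its layer penalties, and with them the
    activations and Lipschitz constants of the layers, are bounded uniformly in
    the widths (measuring activations in l1 for the fan-in penalty and in sup
    norm for the fan-out penalty). Scaling the penalised side of a hidden unit by
    [1 - t] saves [t lam ||w||] and costs at most [K t ||w|| T], where [T] is the
    l1 norm of the unit's other side; so at a minimiser either [w = 0], and the
    unit can be removed, or [T >= c] for a universal [c]. If the adjacent layer on
    the other side has bounded width, the bounded penalty allows only boundedly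
    many units with [T >= c]. Going from layer to layer starting at the output
    (fan-in) or the input (fan-out), this bounds all widths: every network is
    matched by one of bounded widths, and, after padding with zero units, by one
    of a single fixed choice of widths. *)

(** * Finite sums *)

Lemma sumR_ext n f g :
  (forall i, (i < n)%nat -> f i = g i) -> sumR n f = sumR n g.
Proof.
  induction n as [|n IH]; simpl; intros H; [reflexivity|].
  rewrite IH by (intros; apply H; lia). rewrite H by lia. reflexivity.
Qed.

Lemma sumR_le n f g :
  (forall i, (i < n)%nat -> f i <= g i) -> sumR n f <= sumR n g.
Proof.
  induction n as [|n IH]; simpl; intros H; [lra|].
  apply Rplus_le_compat; [apply IH; intros; apply H; lia | apply H; lia].
Qed.

Lemma sumR_const n c : sumR n (fun _ => c) = INR n * c.
Proof.
  induction n as [|n IH]; [simpl; ring|].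
  rewrite S_INR. simpl. rewrite IH. ring.
Qed.

Lemma sumR_eq0 n f : (forall i, (i < n)%nat -> f i = 0) -> sumR n f = 0.
Proof.
  intros H. rewrite (sumR_ext n f (fun _ => 0) H), sumR_const. ring.
Qed.

Lemma sumR_nonneg n f : (forall i, (i < n)%nat -> 0 <= f i) -> 0 <= sumR n f.
Proof.
  intros H. rewrite <- (sumR_eq0 n (fun _ => 0)) by reflexivity.
  now apply sumR_le.
Qed.

Lemma sumR_plus n f g : sumR n (fun i => f i + g i) = sumR n f + sumR n g.
Proof. induction n as [|n IH]; simpl; [ring|]. rewrite IH. ring. Qed.

Lemma sumR_scal n c f : sumR n (fun i => c * f i) = c * sumR n f.
Proof. induction n as [|n IH]; simpl; [ring|]. rewrite IH. ring. Qed.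

Lemma sumR_swap m n (f : nat -> nat -> R) :
  sumR m (fun i => sumR n (fun j => f i j)) = sumR n (fun j => sumR m (fun i => f i j)).
Proof.
  induction m as [|m IH]; simpl.
  - now rewrite sumR_eq0.
  - now rewrite IH, sumR_plus.
Qed.

Lemma Rabs_sumR_le n f : Rabs (sumR n f) <= sumR n (fun i => Rabs (f i)).
Proof.
  induction n as [|n IH]; simpl; [rewrite Rabs_R0; lra|].
  eapply Rle_trans; [apply Rabs_triang|]. lra.
Qed.

Lemma sumR_pad n n' f :
  (n <= n')%nat -> (forall i, (n <= i < n')%nat -> f i = 0) -> sumR n' f = sumR n f.
Proof.
  intros Hle. induction Hle as [|m Hle IH]; intros H; [reflexivity|].
  simpl. rewrite IH by (intros; apply H; lia). rewrite H by lia. ring.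
Qed.

Lemma sumR_single n j f :
  (j < n)%nat -> (forall i, (i < n)%nat -> i <> j -> f i = 0) -> sumR n f = f j.
Proof.
  intros Hj H.
  rewrite (sumR_pad (S j) n) by (try lia; intros; apply H; lia).
  simpl. rewrite sumR_eq0 by (intros; apply H; lia). ring.
Qed.

Lemma sumR_update n j f g :
  (j < n)%nat -> (forall i, (i < n)%nat -> i <> j -> f i = g i) ->
  sumR n f = sumR n g + (f j - g j).
Proof.
  intros Hj H.
  rewrite <- (sumR_single n j (fun i => f i - g i)); [|exact Hj|].
  - rewrite <- sumR_plus. apply sumR_ext. intros. ring.
  - intros i Hi Hij. rewrite H by assumption. ring.
Qed.

Lemma sumR_term_le n f i :
  (forall i, (i < n)%nat -> 0 <= f i) -> (i < n)%nat -> f i <= sumR n f.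
Proof.
  intros H Hi.
  rewrite (sumR_update n i f (fun k => if Nat.eq_dec k i then 0 else f k)); [|exact Hi|].
  - destruct (Nat.eq_dec i i) as [_|]; [|lia].
    enough (0 <= sumR n (fun k => if Nat.eq_dec k i then 0 else f k)) by lra.
    apply sumR_nonneg. intros k Hk. destruct (Nat.eq_dec k i); [lra|auto].
  - intros k Hk Hki. destruct (Nat.eq_dec k i); [lia|reflexivity].
Qed.

(** Pigeonhole. The threshold uses the upper bound [N], so it does not depend on [n]; dividing by
    [N + 1] makes the contradiction strict and keeps [N = 0] harmless. *)
Lemma sumR_large_term n N c f :
  (n <= N)%nat -> 0 < c -> c <= sumR n f ->
  exists i, (i < n)%nat /\ c / (INR N + 1) <= f i.
Proof.
  intros Hn Hc Hs. apply NNPP. intros Hno.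
  assert (HN : 0 < INR N + 1) by (pose proof (pos_INR N); lra).
  assert (H : sumR n f <= sumR n (fun _ => c / (INR N + 1))).
  { apply sumR_le. intros i Hi. apply Rnot_lt_le. intros Hlt.
    apply Hno. exists i. split; [exact Hi|lra]. }
  rewrite sumR_const in H.
  assert (Hlt : INR n * (c / (INR N + 1)) < c).
  { apply Rlt_le_trans with ((INR N + 1) * (c / (INR N + 1))).
    - apply Rmult_lt_compat_r; [now apply Rdiv_lt_0_compat|].
      apply le_INR in Hn. lra.
    - right. field. lra. }
  lra.
Qed.

(** The increasing injection whose image omits exactly [j]; it reindexes what is left after a
    deletion. *)
Definition skip (j i : nat) : nat := if Nat.ltb i j then i else S i.

Lemma skip_lt j n i : (i < n)%nat -> (skip j i < S n)%nat.
Proof. unfold skip. destruct (Nat.ltb_spec i j); lia. Qed.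

Lemma sumR_skip n j f :
  (j < S n)%nat -> sumR (S n) f = sumR n (fun i => f (skip j i)) + f j.
Proof.
  revert j. induction n as [|n IH]; intros j Hj.
  - replace j with 0%nat by lia. simpl. ring.
  - destruct (Nat.eq_dec j (S n)) as [->|Hne].
    + change (sumR (S (S n)) f) with (sumR (S n) f + f (S n)). f_equal.
      apply sumR_ext. intros i Hi. unfold skip.
      destruct (Nat.ltb_spec i (S n)); [reflexivity|lia].
    + change (sumR (S (S n)) f) with (sumR (S n) f + f (S n)).
      (* Here [j <= n], so [skip j] sends the last index [n] of the shorter sum to [S n]. *)
      rewrite (IH j) by lia. simpl. unfold skip at 3.
      destruct (Nat.ltb_spec n j); [lia|]. ring.
Qed.

Lemma is_lim_seq_sumR m (u : nat -> nat -> R) (l : nat -> R) :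
  (forall i, (i < m)%nat -> is_lim_seq (fun n => u n i) (l i)) ->
  is_lim_seq (fun n => sumR m (u n)) (sumR m l).
Proof.
  induction m as [|m IH]; simpl; intros H; [apply is_lim_seq_const|].
  apply is_lim_seq_plus'; [apply IH; intros; apply H; lia | apply H; lia].
Qed.

(** * The sup norm *)

Lemma supnorm_nonneg n u : 0 <= supnorm n u.
Proof.
  induction n as [|n IH]; simpl; [lra|].
  eapply Rle_trans; [exact IH|apply Rmax_l].
Qed.

Lemma supnorm_ge n u i : (i < n)%nat -> Rabs (u i) <= supnorm n u.
Proof.
  induction n as [|n IH]; simpl; intros Hi; [lia|].
  destruct (Nat.eq_dec i n) as [->|Hne]; [apply Rmax_r|].
  eapply Rle_trans; [apply IH; lia|apply Rmax_l].
Qed.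

Lemma supnorm_lub n u c :
  0 <= c -> (forall i, (i < n)%nat -> Rabs (u i) <= c) -> supnorm n u <= c.
Proof.
  intros Hc. induction n as [|n IH]; simpl; intros H; [exact Hc|].
  apply Rmax_lub; [apply IH; intros; apply H; lia | apply H; lia].
Qed.

(** * Powers and p-norms *)

Lemma rpow_nonneg x a : 0 <= rpow x a.
Proof.
  unfold rpow. destruct (Rlt_dec 0 x); [left; apply exp_pos|lra].
Qed.

Lemma rpow_pos x a : 0 < x -> 0 < rpow x a.
Proof. unfold rpow. intros H. destruct (Rlt_dec 0 x); [apply exp_pos|lra]. Qed.

Lemma rpow_0 a : rpow 0 a = 0.
Proof. unfold rpow. destruct (Rlt_dec 0 0); lra. Qed.

Lemma rpow_le x y a : 0 < a -> x <= y -> rpow x a <= rpow y a.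
Proof.
  intros Ha Hxy. destruct (Rlt_dec 0 x) as [Hx|Hx].
  - unfold rpow. destruct (Rlt_dec 0 x), (Rlt_dec 0 y); try lra.
    apply Rle_Rpower_l; lra.
  - unfold rpow at 1. destruct (Rlt_dec 0 x); [lra|]. apply rpow_nonneg.
Qed.

Lemma rpow_mult x y a : 0 <= x -> 0 <= y -> rpow (x * y) a = rpow x a * rpow y a.
Proof.
  intros [Hx|<-] [Hy|<-]; rewrite ?Rmult_0_l, ?Rmult_0_r, ?rpow_0; try ring.
  unfold rpow. pose proof (Rmult_lt_0_compat x y Hx Hy).
  destruct (Rlt_dec 0 x), (Rlt_dec 0 y), (Rlt_dec 0 (x * y)); try lra.
  symmetry. now apply Rpower_mult_distr.
Qed.

Lemma rpow_rpow x a b : 0 <= x -> a * b = 1 -> rpow (rpow x a) b = x.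
Proof.
  intros [Hx|<-] Hab; [|now rewrite !rpow_0].
  pose proof (rpow_pos x a Hx) as Hp. unfold rpow in *.
  destruct (Rlt_dec 0 x); [|lra].
  destruct (Rlt_dec 0 (Rpower x a)); [|lra].
  rewrite Rpower_mult, Hab. now apply Rpower_1.
Qed.

(** At a positive limit this is continuity of [Rpower]; at limit 0 the explicit threshold [eps] to
    the power [/ a] works. *)
Lemma is_lim_seq_rpow (u : nat -> R) (l a : R) :
  0 < a -> (forall n, 0 <= u n) -> is_lim_seq u l ->
  is_lim_seq (fun n => rpow (u n) a) (rpow l a).
Proof.
  intros Ha Hu Hl.
  assert (H0 : 0 <= l).
  { apply (is_lim_seq_le (fun _ => 0) u 0 l Hu); [apply is_lim_seq_const|exact Hl]. }
  apply is_lim_seq_spec. apply is_lim_seq_spec in Hl. intros eps.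
  destruct H0 as [H0|<-].
  - assert (Hlim : is_lim_seq (fun n => Rpower (u n) a) (Rpower l a)).
    { apply (is_lim_seq_continuous (fun x => Rpower x a)).
      - apply derivable_continuous_pt. eexists. now apply derivable_pt_lim_power.
      - now apply is_lim_seq_spec. }
    apply is_lim_seq_spec in Hlim.
    (* Radius [l] around [l] keeps the terms eventually positive, where [rpow] is [Rpower]. *)
    specialize (Hlim eps). specialize (Hl (mkposreal l H0)).
    generalize (filter_and _ _ Hl Hlim). apply filter_imp.
    simpl. intros n [H1 H2]. unfold rpow.
    apply Rabs_def2 in H1.
    destruct (Rlt_dec 0 (u n)); [|lra]. destruct (Rlt_dec 0 l); [exact H2|lra].
  - pose proof (rpow_pos (pos eps) (/ a) (cond_pos eps)) as Hd.
    specialize (Hl (mkposreal _ Hd)). revert Hl. apply filter_imp. simpl.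
    intros n Hn. rewrite rpow_0, Rminus_0_r in *.
    rewrite (Rabs_pos_eq _ (Hu n)) in Hn.
    rewrite Rabs_pos_eq by apply rpow_nonneg.
    destruct (Rle_lt_dec (pos eps) (rpow (u n) a)) as [Hge|]; [|assumption].
    apply (rpow_le _ _ (/ a)) in Hge; [|now apply Rinv_0_lt_compat].
    rewrite (rpow_rpow (u n)) in Hge; [lra|apply Hu|field; lra].
Qed.

Section PNorm.

Variable p : R.
Hypothesis Hp : 1 <= p.

Lemma inv_p_pos : 0 < / p.
Proof. apply Rinv_0_lt_compat. lra. Qed.

Lemma pnorm_nonneg n v : 0 <= pnorm n p v.
Proof. apply rpow_nonneg. Qed.

Lemma pnorm_ext n u v : (forall i, (i < n)%nat -> u i = v i) -> pnorm n p u = pnorm n p v.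
Proof.
  intros H. unfold pnorm. f_equal. apply sumR_ext. intros i Hi. now rewrite H.
Qed.

Lemma pnorm_eq0 n v : (forall i, (i < n)%nat -> v i = 0) -> pnorm n p v = 0.
Proof.
  intros H. unfold pnorm. rewrite sumR_eq0, rpow_0; [reflexivity|].
  intros i Hi. now rewrite H, Rabs_R0, rpow_0.
Qed.

Lemma entry_le_pnorm n v i : (i < n)%nat -> Rabs (v i) <= pnorm n p v.
Proof.
  intros Hi. rewrite <- (rpow_rpow (Rabs (v i)) p (/ p)).
  - apply rpow_le; [apply inv_p_pos|].
    apply (sumR_term_le n (fun i => rpow (Rabs (v i)) p)); [|exact Hi].
    intros. apply rpow_nonneg.
  - apply Rabs_pos.
  - field. lra.
Qed.

Lemma pnorm_scal n c v : 0 <= c -> pnorm n p (fun i => c * v i) = c * pnorm n p v.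
Proof.
  intros Hc. unfold pnorm.
  rewrite (sumR_ext n _ (fun i => rpow c p * rpow (Rabs (v i)) p)).
  - rewrite sumR_scal, rpow_mult; [|apply rpow_nonneg|].
    + rewrite rpow_rpow; [reflexivity|exact Hc|field; lra].
    + apply sumR_nonneg. intros. apply rpow_nonneg.
  - intros i Hi. rewrite Rabs_mult, (Rabs_pos_eq c Hc).
    apply rpow_mult; [exact Hc|apply Rabs_pos].
Qed.

Lemma pnorm_pad n n' v :
  (n <= n')%nat -> (forall i, (n <= i < n')%nat -> v i = 0) -> pnorm n' p v = pnorm n p v.
Proof.
  intros Hn H. unfold pnorm. f_equal. apply sumR_pad; [exact Hn|].
  intros i Hi. now rewrite H, Rabs_R0, rpow_0.
Qed.

Lemma pnorm_skip_le n j v :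
  (j < S n)%nat -> pnorm n p (fun i => v (skip j i)) <= pnorm (S n) p v.
Proof.
  intros Hj. unfold pnorm. apply rpow_le; [apply inv_p_pos|].
  rewrite (sumR_skip n j) by exact Hj.
  pose proof (rpow_nonneg (Rabs (v j)) p). lra.
Qed.

Lemma sum_rpow_le n v B :
  pnorm n p v <= B -> sumR n (fun i => rpow (Rabs (v i)) p) <= rpow B p.
Proof.
  intros H.
  rewrite <- (rpow_rpow (sumR n (fun i => rpow (Rabs (v i)) p)) (/ p) p).
  - apply rpow_le; [lra|exact H].
  - apply sumR_nonneg. intros. apply rpow_nonneg.
  - field. lra.
Qed.

Lemma is_lim_seq_pnorm m (u : nat -> nat -> R) (l : nat -> R) :
  (forall i, (i < m)%nat -> is_lim_seq (fun n => u n i) (l i)) ->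
  is_lim_seq (fun n => pnorm m p (u n)) (pnorm m p l).
Proof.
  intros H. unfold pnorm. apply is_lim_seq_rpow.
  - apply inv_p_pos.
  - intros n. apply sumR_nonneg. intros. apply rpow_nonneg.
  - apply (is_lim_seq_sumR m (fun n i => rpow (Rabs (u n i)) p)
             (fun i => rpow (Rabs (l i)) p)).
    intros i Hi. apply is_lim_seq_rpow; [lra|intros; apply Rabs_pos|].
    apply (is_lim_seq_abs _ (Finite (l i))). now apply H.
Qed.

(** * The penalty of one layer *)

(** Fan-in penalty of one matrix, without the factor [lam]. The fan-out penalty is the same
    expression for the transpose, so facts are proved for columns and then transferred. *)
Definition colpen (m n : nat) (M : nat -> nat -> R) : R :=
  sumR n (fun j => pnorm m p (fun i => M i j)).

(* [true] selects the fan-in penalty, [false] the fan-out penalty. *)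
Definition lpen (b : bool) (m n : nat) (M : nat -> nat -> R) : R :=
  if b then colpen m n M else colpen n m (fun i j => M j i).

Lemma colpen_nonneg m n M : 0 <= colpen m n M.
Proof. apply sumR_nonneg. intros. apply pnorm_nonneg. Qed.

Lemma lpen_nonneg b m n M : 0 <= lpen b m n M.
Proof. destruct b; apply colpen_nonneg. Qed.

Lemma pnorm_col_le_colpen m n M j :
  (j < n)%nat -> pnorm m p (fun i => M i j) <= colpen m n M.
Proof.
  intros Hj. apply (sumR_term_le n (fun j => pnorm m p (fun i => M i j))); [|exact Hj].
  intros. apply pnorm_nonneg.
Qed.

Lemma entry_le_colpen m n M i j :
  (i < m)%nat -> (j < n)%nat -> Rabs (M i j) <= colpen m n M.
Proof.
  intros Hi Hj. apply Rle_trans with (pnorm m p (fun i => M i j)).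
  - now apply (entry_le_pnorm m (fun i => M i j)).
  - now apply pnorm_col_le_colpen.
Qed.

Lemma entry_le_lpen b m n M i j :
  (i < m)%nat -> (j < n)%nat -> Rabs (M i j) <= lpen b m n M.
Proof.
  intros Hi Hj. destruct b; simpl.
  - now apply entry_le_colpen.
  - now apply (entry_le_colpen n m (fun i j => M j i)).
Qed.

Lemma colpen_ext m n M N :
  (forall i j, (i < m)%nat -> (j < n)%nat -> M i j = N i j) -> colpen m n M = colpen m n N.
Proof.
  intros H. apply sumR_ext. intros j Hj. apply pnorm_ext. auto.
Qed.

Lemma lpen_ext b m n M N :
  (forall i j, (i < m)%nat -> (j < n)%nat -> M i j = N i j) -> lpen b m n M = lpen b m n N.
Proof. intros H. destruct b; apply colpen_ext; auto. Qed.

Lemma colpen_eq0 m n M :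
  (forall i j, (i < m)%nat -> (j < n)%nat -> M i j = 0) -> colpen m n M = 0.
Proof. intros H. apply sumR_eq0. intros j Hj. apply pnorm_eq0. auto. Qed.

Lemma lpen_eq0 b m n M :
  (forall i j, (i < m)%nat -> (j < n)%nat -> M i j = 0) -> lpen b m n M = 0.
Proof. intros H. destruct b; apply colpen_eq0; auto. Qed.

Lemma is_lim_seq_colpen r c (u : nat -> nat -> nat -> R) (l : nat -> nat -> R) :
  (forall i j, (i < r)%nat -> (j < c)%nat -> is_lim_seq (fun n => u n i j) (l i j)) ->
  is_lim_seq (fun n => colpen r c (u n)) (colpen r c l).
Proof.
  intros H. apply is_lim_seq_sumR. intros j Hj.
  apply (is_lim_seq_pnorm r (fun n i => u n i j) (fun i => l i j)). auto.
Qed.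

Lemma is_lim_seq_lpen b r c (u : nat -> nat -> nat -> R) (l : nat -> nat -> R) :
  (forall i j, (i < r)%nat -> (j < c)%nat -> is_lim_seq (fun n => u n i j) (l i j)) ->
  is_lim_seq (fun n => lpen b r c (u n)) (lpen b r c l).
Proof.
  intros H. destruct b; simpl.
  - now apply is_lim_seq_colpen.
  - apply (is_lim_seq_colpen c r (fun n i j => u n j i)). auto.
Qed.

Lemma colpen_skip_row_le m n M i0 :
  (i0 < S m)%nat -> colpen m n (fun i j => M (skip i0 i) j) <= colpen (S m) n M.
Proof.
  intros H. apply sumR_le. intros j Hj. now apply (pnorm_skip_le m i0 (fun i => M i j)).
Qed.

Lemma colpen_skip_col_le m n M j0 :
  (j0 < S n)%nat -> colpen m n (fun i j => M i (skip j0 j)) <= colpen m (S n) M.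
Proof.
  intros H. unfold colpen. rewrite (sumR_skip n j0) by exact H.
  pose proof (pnorm_nonneg m (fun i => M i j0)). lra.
Qed.

Lemma lpen_skip_row_le b m n M i0 :
  (i0 < S m)%nat -> lpen b m n (fun i j => M (skip i0 i) j) <= lpen b (S m) n M.
Proof.
  intros H. destruct b; simpl.
  - now apply colpen_skip_row_le.
  - now apply (colpen_skip_col_le n m (fun i j => M j i)).
Qed.

Lemma lpen_skip_col_le b m n M j0 :
  (j0 < S n)%nat -> lpen b m n (fun i j => M i (skip j0 j)) <= lpen b m (S n) M.
Proof.
  intros H. destruct b; simpl.
  - now apply colpen_skip_col_le.
  - now apply (colpen_skip_row_le n m (fun i j => M j i)).
Qed.

Lemma colpen_pad m n m' n' M :
  (m <= m')%nat -> (n <= n')%nat ->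
  (forall i j, (m <= i)%nat \/ (n <= j)%nat -> M i j = 0) ->
  colpen m' n' M = colpen m n M.
Proof.
  intros Hm Hn H. unfold colpen.
  rewrite (sumR_pad n n') by (try assumption; intros j Hj; apply pnorm_eq0; intros; apply H; lia).
  apply sumR_ext. intros j Hj. apply pnorm_pad; [exact Hm|]. intros. apply H. lia.
Qed.

Lemma lpen_pad b m n m' n' M :
  (m <= m')%nat -> (n <= n')%nat ->
  (forall i j, (m <= i)%nat \/ (n <= j)%nat -> M i j = 0) ->
  lpen b m' n' M = lpen b m n M.
Proof.
  intros Hm Hn H. destruct b; apply colpen_pad; auto. intros. apply H. lia.
Qed.

(** Homogeneity of the norm on column [j]; [t <= 1] keeps the factor [1 - t] nonnegative. *)
Lemma colpen_shrink m n M N j t :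
  (j < n)%nat -> t <= 1 ->
  (forall i k, (i < m)%nat -> (k < n)%nat -> k <> j -> N i k = M i k) ->
  (forall i, (i < m)%nat -> N i j = (1 - t) * M i j) ->
  colpen m n N = colpen m n M - t * pnorm m p (fun i => M i j).
Proof.
  intros Hj Ht H1 H2. unfold colpen.
  rewrite (sumR_update n j _ (fun k => pnorm m p (fun i => M i k)) Hj).
  - rewrite (pnorm_ext m (fun i => N i j) (fun i => (1 - t) * M i j)) by exact H2.
    rewrite (pnorm_scal m (1 - t) (fun i => M i j)) by lra. ring.
  - intros k Hk Hkj. apply pnorm_ext. auto.
Qed.

(* Every row has an entry of size at least [c / (N + 1)], and each column has room
   for only boundedly many of those. *)
Lemma colpen_count m n N M B c :
  (n <= N)%nat -> 0 < c -> colpen m n M <= B ->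
  (forall i, (i < m)%nat -> c <= sumR n (fun j => Rabs (M i j))) ->
  INR m <= INR N * rpow B p / rpow (c / (INR N + 1)) p.
Proof.
  intros Hn Hc HB H. set (r := c / (INR N + 1)).
  assert (Hr : 0 < r).
  { unfold r. apply Rdiv_lt_0_compat; [exact Hc|]. pose proof (pos_INR N). lra. }
  pose proof (rpow_pos r p Hr) as Hrp.
  apply Rmult_le_reg_r with (rpow r p); [exact Hrp|].
  replace (INR N * rpow B p / rpow r p * rpow r p) with (INR N * rpow B p) by (field; lra).
  apply Rle_trans with (sumR m (fun i => sumR n (fun j => rpow (Rabs (M i j)) p))).
  - rewrite <- sumR_const. apply sumR_le. intros i Hi.
    destruct (sumR_large_term n N c (fun j => Rabs (M i j)) Hn Hc (H i Hi)) as [j [Hj Hle]].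
    apply Rle_trans with (rpow (Rabs (M i j)) p); [apply rpow_le; [lra|exact Hle]|].
    apply (sumR_term_le n (fun j => rpow (Rabs (M i j)) p)); [|exact Hj].
    intros. apply rpow_nonneg.
  (* After exchanging the sums, each of the at most [N] columns contributes at most [rpow B p]. *)
  - rewrite sumR_swap. apply Rle_trans with (sumR n (fun _ => rpow B p)).
    + apply sumR_le. intros j Hj. apply (sum_rpow_le m (fun i => M i j)).
      eapply Rle_trans; [apply (pnorm_col_le_colpen m n M j Hj)|exact HB].
    + rewrite sumR_const. apply Rmult_le_compat_r; [apply rpow_nonneg|now apply le_INR].
Qed.

(* The norm on layer outputs for which [x |-> x M] is bounded by the penalty of [M]. *)
Definition nu (b : bool) (n : nat) (v : nat -> R) : R :=
  if b then sumR n (fun i => Rabs (v i)) else supnorm n v.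

Lemma nu_nonneg b n v : 0 <= nu b n v.
Proof.
  destruct b; simpl; [|apply supnorm_nonneg].
  apply sumR_nonneg. intros. apply Rabs_pos.
Qed.

Lemma entry_le_nu b n v i : (i < n)%nat -> Rabs (v i) <= nu b n v.
Proof.
  intros Hi. destruct b; simpl; [|now apply supnorm_ge].
  apply (sumR_term_le n (fun i => Rabs (v i))); [|exact Hi]. intros. apply Rabs_pos.
Qed.

(** Carries entrywise Lipschitz bounds on the nonlinearities over to whole layers, for both
    norms. *)
Lemma nu_le b n u v C :
  0 <= C -> (forall i, (i < n)%nat -> Rabs (u i) <= C * Rabs (v i)) ->
  nu b n u <= C * nu b n v.
Proof.
  intros HC H. destruct b; simpl.
  - rewrite <- sumR_scal. now apply sumR_le.
  - apply supnorm_lub.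
    + apply Rmult_le_pos; [exact HC|apply supnorm_nonneg].
    + intros i Hi. eapply Rle_trans; [now apply H|].
      apply Rmult_le_compat_l; [exact HC|now apply supnorm_ge].
Qed.

Lemma nu_ext b n u v : (forall i, (i < n)%nat -> u i = v i) -> nu b n u = nu b n v.
Proof.
  assert (Hle : forall u v, (forall i, (i < n)%nat -> u i = v i) -> nu b n u <= nu b n v).
  { intros u' v' H. rewrite <- (Rmult_1_l (nu b n v')). apply nu_le; [lra|].
    intros i Hi. rewrite H by exact Hi. lra. }
  intros H. apply Rle_antisym; apply Hle; [exact H|]. intros. symmetry. auto.
Qed.

Lemma Rabs_dot_le_l1 m u v c :
  (forall i, (i < m)%nat -> Rabs (v i) <= c) ->
  Rabs (sumR m (fun i => u i * v i)) <= nu true m u * c.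
Proof.
  intros H. eapply Rle_trans; [apply Rabs_sumR_le|].
  rewrite Rmult_comm. simpl. rewrite <- sumR_scal. apply sumR_le. intros i Hi.
  rewrite Rabs_mult, Rmult_comm.
  apply Rmult_le_compat_r; [apply Rabs_pos|now apply H].
Qed.

(** An entry is at most the p-norm of its column or row. In l1, output [j] is at most the norm of
    [v] times that of column [j]; in sup norm, every output is at most the norm of [v] times the sum
    of the row norms. *)
Lemma nu_mulmx b m n v M :
  nu b n (fun j => sumR m (fun i => v i * M i j)) <= nu b m v * lpen b m n M.
Proof.
  destruct b; unfold lpen, colpen.
  - rewrite <- sumR_scal. apply sumR_le. intros j Hj.
    apply (Rabs_dot_le_l1 m v (fun i => M i j)). intros i Hi.
    now apply (entry_le_pnorm m (fun i => M i j)).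
  - pose proof (supnorm_nonneg m v) as Hv. simpl. apply supnorm_lub.
    + apply Rmult_le_pos; [exact Hv|]. apply sumR_nonneg. intros. apply pnorm_nonneg.
    + intros j Hj. eapply Rle_trans; [apply Rabs_sumR_le|].
      rewrite <- sumR_scal. apply sumR_le. intros i Hi. rewrite Rabs_mult.
      apply Rmult_le_compat; try apply Rabs_pos; [now apply supnorm_ge|].
      now apply (entry_le_pnorm n (fun j => M i j)).
Qed.

End PNorm.
(** * Local Lipschitz bounds *)

Definition loc_lipschitz (f : R -> R) : Prop :=
  forall S, 0 <= S -> exists Q, 0 <= Q /\
    forall s t, Rabs s <= S -> Rabs t <= S -> Rabs (f s - f t) <= Q * Rabs (s - t).

Lemma difference_quotient_bound f s h l K eps :
  h <> 0 -> Rabs l <= K -> Rabs ((f (s + h) - f s) / h - l) < eps ->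
  Rabs (f (s + h) - f s) <= (K + eps) * Rabs h.
Proof.
  intros Hh Hl H.
  replace (f (s + h) - f s) with ((f (s + h) - f s) / h * h) by (field; exact Hh).
  rewrite Rabs_mult. apply Rmult_le_compat_r; [apply Rabs_pos|].
  replace ((f (s + h) - f s) / h) with (((f (s + h) - f s) / h - l) + l) by ring.
  eapply Rle_trans; [apply Rabs_triang|]. lra.
Qed.

(* The supremum of the points up to which the slope bound [K + eps] holds
   belongs to the set by the left derivative, and equals [b] by the right one. *)
Lemma one_sided_mean_value_eps f a b K eps :
  a <= b -> 0 < eps ->
  (forall s, a <= s <= b ->
     (exists dl, left_deriv f s dl /\ Rabs dl <= K) /\
     (exists dr, right_deriv f s dr /\ Rabs dr <= K)) ->
  Rabs (f b - f a) <= (K + eps) * (b - a).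
Proof.
  intros Hab Heps H.
  set (P := fun x => a <= x <= b /\ Rabs (f x - f a) <= (K + eps) * (x - a)).
  assert (Pa : P a).
  { split; [lra|]. replace (f a - f a) with 0 by ring. rewrite Rabs_R0. lra. }
  destruct (completeness P) as [c [Hub Hlub]].
  { exists b. intros x [Hx _]. lra. }
  { now exists a. }
  assert (Hac : a <= c) by now apply Hub.
  assert (Hcb : c <= b) by (apply Hlub; intros x [Hx _]; lra).
  destruct (H c (conj Hac Hcb)) as [[dl [Hdl Kdl]] [dr [Hdr Kdr]]].
  assert (Pc : P c).
  { split; [lra|].
    destruct (Hdl eps Heps) as [delta [Hd Hq]].
    assert (Hx : exists x, P x /\ c - delta < x).
    { apply NNPP. intros Hno.
      enough (c <= c - delta) by lra.
      apply Hlub. intros x Px. apply Rnot_lt_le. intros Hlt. apply Hno. now exists x. }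
    destruct Hx as [x [Px Hx]].
    pose proof (Hub x Px) as Hxc. destruct Px as [Hxab Px].
    destruct Hxc as [Hxc|<-]; [|exact Px].
    pose proof (difference_quotient_bound f c (x - c) dl K eps) as Hb.
    replace (c + (x - c)) with x in Hb by ring.
    assert (Hb' : Rabs (f x - f c) <= (K + eps) * Rabs (x - c)).
    { apply Hb; [lra|exact Kdl|]. replace (f x) with (f (c + (x - c))) by (f_equal; ring).
      apply Hq. lra. }
    rewrite (Rabs_left (x - c)) in Hb' by lra.
    replace (f c - f a) with (- (f x - f c) + (f x - f a)) by ring.
    eapply Rle_trans; [apply Rabs_triang|]. rewrite Rabs_Ropp.
    nra. }
  (* If [c < b], the right derivative puts some [c + h] into [P], beyond its supremum. *)
  destruct Hcb as [Hcb|<-]; [exfalso|apply Pc].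
  destruct (Hdr eps Heps) as [delta [Hd Hq]].
  set (h := Rmin (delta / 2) (b - c)).
  assert (Hh : 0 < h <= b - c /\ h < delta).
  { unfold h. pose proof (Rmin_l (delta / 2) (b - c)). pose proof (Rmin_r (delta / 2) (b - c)).
    assert (0 < Rmin (delta / 2) (b - c)) by (apply Rmin_glb_lt; lra). lra. }
  assert (Hb : Rabs (f (c + h) - f c) <= (K + eps) * Rabs h).
  { apply (difference_quotient_bound f c h dr); [lra|exact Kdr|apply Hq; lra]. }
  rewrite (Rabs_pos_eq h) in Hb by lra.
  enough (c + h <= c) by lra.
  apply Hub. split; [lra|].
  replace (f (c + h) - f a) with ((f (c + h) - f c) + (f c - f a)) by ring.
  eapply Rle_trans; [apply Rabs_triang|]. destruct Pc as [_ Pc]. nra.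
Qed.

Lemma one_sided_mean_value f a b K :
  a <= b ->
  (forall s, a <= s <= b ->
     (exists dl, left_deriv f s dl /\ Rabs dl <= K) /\
     (exists dr, right_deriv f s dr /\ Rabs dr <= K)) ->
  Rabs (f b - f a) <= K * (b - a).
Proof.
  intros Hab H. apply Rle_plus_epsilon. intros eps Heps.
  (* The denominator stays positive when [a = b] and keeps the total error at most [eps]. *)
  assert (Hpos : 0 < eps / (b - a + 1)) by (apply Rdiv_lt_0_compat; lra).
  eapply Rle_trans; [apply (one_sided_mean_value_eps f a b K _ Hab Hpos H)|].
  assert (eps / (b - a + 1) * (b - a) <= eps).
  { apply Rle_trans with (eps / (b - a + 1) * (b - a + 1)); [|right; field; lra].
    apply Rmult_le_compat_l; lra. }
  lra.
Qed.

(** The interval of radius [S] contains the segment between any two of its points, so the mean value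
    bound applies with [K = b2 S]. *)
Lemma one_sided_deriv_loc_lipschitz f b2 :
  (forall s, (exists dl, left_deriv f s dl) /\ (exists dr, right_deriv f s dr)) ->
  (forall S, 0 <= S -> 0 <= b2 S) ->
  (forall S s, 0 <= S -> Rabs s <= S ->
     (forall dl, left_deriv f s dl -> Rabs dl <= b2 S) /\
     (forall dr, right_deriv f s dr -> Rabs dr <= b2 S)) ->
  loc_lipschitz f.
Proof.
  intros Hd Hpos Hb S HS. exists (b2 S). split; [now apply Hpos|].
  assert (Hle : forall s t, Rabs s <= S -> Rabs t <= S -> s <= t ->
            Rabs (f t - f s) <= b2 S * (t - s)).
  { intros s t Hs Ht Hst. apply one_sided_mean_value; [exact Hst|]. intros r Hr.
    assert (HrS : Rabs r <= S).
    { apply Rabs_le. apply Rabs_le_between in Hs. apply Rabs_le_between in Ht. lra. }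
    destruct (Hd r) as [[dl Hdl] [dr Hdr]], (Hb S r HS HrS) as [Hl Hr'].
    split; [exists dl|exists dr]; auto. }
  intros s t Hs Ht. destruct (Rle_dec s t) as [Hst|Hst].
  - rewrite (Rabs_minus_sym (f s)), (Rabs_minus_sym s), (Rabs_pos_eq (t - s)) by lra.
    now apply Hle.
  - rewrite (Rabs_pos_eq (s - t)) by lra. apply Hle; lra.
Qed.

Lemma is_lim_seq_loc_lipschitz f (u : nat -> R) (l : R) :
  loc_lipschitz f -> is_lim_seq u l -> is_lim_seq (fun n => f (u n)) (f l).
Proof.
  (* Eventually [u] lies within 1 of [l], hence within [Rabs l + 1] of 0; the rest is a squeeze. *)
  intros Hf Hu. destruct (Hf (Rabs l + 1)) as [Q [HQ HL]].
  { pose proof (Rabs_pos l). lra. }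
  assert (Hd : is_lim_seq (fun n => Q * Rabs (u n - l)) 0).
  { replace (Finite 0) with (Rbar_mult Q 0) by (simpl; f_equal; ring).
    apply is_lim_seq_scal_l. apply (is_lim_seq_abs_0 (fun n => u n - l)).
    replace (Finite 0) with (Finite (l - l)) by (f_equal; ring).
    apply is_lim_seq_minus'; [exact Hu|apply is_lim_seq_const]. }
  apply (is_lim_seq_le_le_loc (fun n => f l - Q * Rabs (u n - l)) _
           (fun n => f l + Q * Rabs (u n - l))).
  - apply is_lim_seq_spec in Hu. generalize (Hu (mkposreal 1 Rlt_0_1)).
    apply filter_imp. simpl. intros n Hn.
    assert (Hb : Rabs (f (u n) - f l) <= Q * Rabs (u n - l)).
    { apply HL; [|lra]. replace (u n) with ((u n - l) + l) by ring.
      eapply Rle_trans; [apply Rabs_triang|]. lra. }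
    apply Rabs_le_between in Hb. lra.
  - replace (Finite (f l)) with (Finite (f l - 0)) by (f_equal; ring).
    apply is_lim_seq_minus'; [apply is_lim_seq_const|exact Hd].
  - replace (Finite (f l)) with (Finite (f l + 0)) by (f_equal; ring).
    apply is_lim_seq_plus'; [apply is_lim_seq_const|exact Hd].
Qed.

Lemma is_vec_minus n u v : is_vec n u -> is_vec n v -> is_vec n (fun i => u i - v i).
Proof. intros Hu Hv i Hi. rewrite Hu, Hv by exact Hi. ring. Qed.

Lemma is_grad_local_bound n F v g b :
  is_vec n v -> is_grad n F v g -> (forall i, (i < n)%nat -> Rabs (g i) <= b) ->
  exists delta, 0 < delta /\
    forall w, is_vec n w -> supnorm n (fun i => w i - v i) < delta ->
      Rabs (F w - F v) <= (INR n * b + 1) * supnorm n (fun i => w i - v i).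
Proof.
  intros Hv Hg Hb. destruct (Hg 1 Rlt_0_1) as [delta [Hd H]].
  exists delta. split; [exact Hd|]. intros w Hw Hs.
  set (u := fun i => w i - v i) in *.
  specialize (H u (is_vec_minus n w v Hw Hv) Hs).
  replace (fun i => v i + u i) with w in H
    by (apply functional_extensionality; intros; unfold u; ring).
  assert (Hdot : Rabs (sumR n (fun i => g i * u i)) <= INR n * b * supnorm n u).
  { eapply Rle_trans; [apply Rabs_sumR_le|].
    rewrite Rmult_assoc, <- sumR_const. apply sumR_le. intros i Hi.
    rewrite Rabs_mult. apply Rmult_le_compat; try apply Rabs_pos; [now apply Hb|].
    now apply supnorm_ge. }
  replace (F w - F v)
    with ((F w - F v - sumR n (fun i => g i * u i)) + sumR n (fun i => g i * u i)) by ring.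
  eapply Rle_trans; [apply Rabs_triang|]. lra.
Qed.

(** * Subsequences *)

Lemma is_lim_seq_inv_S : is_lim_seq (fun n => / (INR n + 1)) 0.
Proof.
  apply (is_lim_seq_ext (fun n => / INR (S n))).
  { intros n. now rewrite S_INR. }
  apply (is_lim_seq_incr_1 (fun n => / INR n)).
  change (Finite 0) with (Rbar_inv p_infty).
  apply is_lim_seq_inv; [apply is_lim_seq_INR|discriminate].
Qed.

(** Bolzano-Weierstrass yields a cluster point; the subsequence is then extracted by choosing
    indices recursively. *)
Lemma bounded_subseq (u : nat -> R) B :
  (forall n, Rabs (u n) <= B) ->
  exists phi, filterlim phi eventually eventually /\
    ex_finite_lim_seq (fun n => u (phi n)).
Proof.
  intros HB.
  destruct (Bolzano_Weierstrass u (fun c => - B <= c <= B)) as [l Hl].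
  { apply compact_P3. }
  { intros n. now apply Rabs_le_between. }
  assert (Hpick : forall q : nat * nat,
            exists k, (snd q <= k)%nat /\ Rabs (u k - l) < / (INR (fst q) + 1)).
  { intros [n N]. simpl.
    assert (He : 0 < / (INR n + 1)) by (apply Rinv_0_lt_compat; pose proof (pos_INR n); lra).
    apply (Hl (fun x => Rabs (x - l) < / (INR n + 1)) N).
    exists (mkposreal _ He). now intros x Hx. }
  apply functional_choice in Hpick. destruct Hpick as [F HF].
  (* The next index is taken beyond [phi m], with tolerance [/ (INR (S m) + 1)]. *)
  set (phi := fix phi n := match n with O => F (0, 0)%nat | S m => F (S m, S (phi m)) end).
  exists phi. split.
  - apply eventually_subseq. intros n.
    destruct (HF (S n, S (phi n))) as [Hle _]. simpl in *. lia.
  - exists l.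
    assert (Hphi : forall n, Rabs (u (phi n) - l) < / (INR n + 1)).
    { intros [|n]; [apply (HF (0, 0)%nat)|apply (HF (S n, S (phi n)))]. }
    pose proof is_lim_seq_inv_S as H0.
    apply (is_lim_seq_le_le (fun n => l - / (INR n + 1)) _ (fun n => l + / (INR n + 1))).
    + intros n. generalize (Hphi n). intros Hn. apply Rabs_def2 in Hn. lra.
    + replace (Finite l) with (Finite (l - 0)) by (f_equal; ring).
      apply is_lim_seq_minus'; [apply is_lim_seq_const|exact H0].
    + replace (Finite l) with (Finite (l + 0)) by (f_equal; ring).
      apply is_lim_seq_plus'; [apply is_lim_seq_const|exact H0].
Qed.

(** One coordinate at a time: passing to a further subsequence keeps the limits already obtained. *)
Lemma bounded_family_subseq {A : Type} (s : list A) (u : nat -> A -> R) B :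
  (forall n a, In a s -> Rabs (u n a) <= B) ->
  exists phi, filterlim phi eventually eventually /\
    forall a, In a s -> ex_finite_lim_seq (fun n => u (phi n) a).
Proof.
  induction s as [|a s IH]; intros HB.
  - exists (fun n => n). split; [apply filterlim_id|]. intros a [].
  - destruct IH as [phi [Hphi Hs]].
    { intros n a' Ha'. apply HB. now right. }
    destruct (bounded_subseq (fun n => u (phi n) a) B) as [psi [Hpsi Ha]].
    { intros n. apply HB. now left. }
    exists (fun n => phi (psi n)). split.
    + now apply filterlim_comp with eventually.
    + intros a' [<-|Ha']; [exact Ha|].
      destruct (Hs a' Ha') as [l Hl]. exists l.
      now apply (is_lim_seq_subseq (fun n => u (phi n) a')).
Qed.

(** * Means over the dataset *)

(* The mean of the empty list is [0], whatever the value of [/ 0]. *)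
Definition mean {A : Type} (D : list A) (F : A -> R) : R :=
  / INR (length D) * fold_right (fun a acc => F a + acc) 0 D.

Lemma mean_ext {A : Type} (D : list A) F G :
  (forall a, In a D -> F a = G a) -> mean D F = mean D G.
Proof.
  intros H. unfold mean. f_equal.
  induction D as [|a D IH]; simpl; [reflexivity|].
  rewrite H by now left. rewrite IH; [reflexivity|]. intros. apply H. now right.
Qed.

Lemma length_mean {A : Type} (D : list A) F :
  INR (length D) * mean D F = fold_right (fun a acc => F a + acc) 0 D.
Proof.
  unfold mean. destruct D as [|a D]; [simpl; ring|].
  rewrite <- Rmult_assoc, Rinv_r, Rmult_1_l; [reflexivity|].
  apply not_0_INR. simpl. lia.
Qed.

Lemma mean_le_plus {A : Type} (D : list A) F G C :
  0 <= C -> (forall a, In a D -> F a <= G a + C) -> mean D F <= mean D G + C.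
Proof.
  (* For the empty dataset both means are 0 and the claim is [0 <= C]. *)
  intros HC H. destruct D as [|a0 D'] eqn:HD.
  - unfold mean. simpl. lra.
  - rewrite <- HD in *.
    assert (Hlen : 0 < INR (length D)) by (apply lt_0_INR; rewrite HD; simpl; lia).
    apply Rmult_le_reg_l with (1 := Hlen).
    rewrite Rmult_plus_distr_l, !length_mean. clear HD Hlen.
    induction D as [|a D IH]; [simpl; lra|].
    change (length (a :: D)) with (S (length D)). rewrite S_INR. simpl.
    pose proof (H a (or_introl eq_refl)).
    pose proof (IH (fun x Hx => H x (or_intror Hx))). lra.
Qed.

Lemma fold_sum_nonneg {A : Type} (D : list A) F :
  (forall a, In a D -> 0 <= F a) -> 0 <= fold_right (fun a acc => F a + acc) 0 D.
Proof.
  induction D as [|a D IH]; simpl; intros H; [lra|].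
  pose proof (H a (or_introl eq_refl)).
  pose proof (IH (fun x Hx => H x (or_intror Hx))). lra.
Qed.

Lemma mean_nonneg {A : Type} (D : list A) F :
  (forall a, In a D -> 0 <= F a) -> 0 <= mean D F.
Proof.
  intros H. unfold mean. destruct D as [|a D]; [simpl; lra|].
  apply Rmult_le_pos; [|now apply fold_sum_nonneg].
  left. apply Rinv_0_lt_compat, lt_0_INR. simpl. lia.
Qed.

Lemma term_le_mean {A : Type} (D : list A) F a :
  (forall a, In a D -> 0 <= F a) -> In a D -> F a <= INR (length D) * mean D F.
Proof.
  rewrite length_mean. induction D as [|a' D IH]; simpl; [tauto|].
  intros H [->|Ha].
  - pose proof (fold_sum_nonneg D F (fun x Hx => H x (or_intror Hx))). lra.
  - pose proof (H a' (or_introl eq_refl)).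
    pose proof (IH (fun x Hx => H x (or_intror Hx)) Ha). lra.
Qed.

Lemma is_lim_seq_mean {A : Type} (D : list A) (u : nat -> A -> R) (l : A -> R) :
  (forall a, In a D -> is_lim_seq (fun n => u n a) (l a)) ->
  is_lim_seq (fun n => mean D (u n)) (mean D l).
Proof.
  intros H. unfold mean.
  apply is_lim_seq_mult'; [apply is_lim_seq_const|].
  induction D as [|a D IH]; simpl; [apply is_lim_seq_const|].
  apply is_lim_seq_plus'; [apply H; now left|].
  apply IH. intros. apply H. now right.
Qed.

Lemma list_uniform_upper {A : Type} (D : list A) (F : A -> R) :
  exists X, 0 <= X /\ forall a, In a D -> F a <= X.
Proof.
  induction D as [|a D [X [HX H]]].
  - exists 0. split; [lra|intros a []].
  - exists (Rmax X (F a)). split; [eapply Rle_trans; [exact HX|apply Rmax_l]|].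
    intros a' [<-|Ha']; [apply Rmax_r|].
    eapply Rle_trans; [now apply H|apply Rmax_l].
Qed.

(** The minimum of finitely many positive radii is positive; this gives one radius for the whole
    dataset. *)
Lemma list_uniform_radius {A : Type} (D : list A) (P : A -> R -> Prop) :
  (forall a r s, P a r -> s <= r -> P a s) ->
  (forall a, In a D -> exists r, 0 < r /\ P a r) ->
  exists r, 0 < r /\ forall a, In a D -> P a r.
Proof.
  intros Hmono. induction D as [|a D IH]; intros H.
  - exists 1. split; [lra|intros a []].
  - destruct (IH (fun x Hx => H x (or_intror Hx))) as [r [Hr Hall]].
    destruct (H a (or_introl eq_refl)) as [s [Hs Ha]].
    exists (Rmin r s). split; [now apply Rmin_glb_lt|].
    intros a' [<-|Ha'].
    + apply Hmono with s; [exact Ha|apply Rmin_r].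
    + apply Hmono with r; [now apply Hall|apply Rmin_l].
Qed.

Lemma nat_uniform_upper L (P : nat -> R -> Prop) :
  (forall l r s, P l r -> r <= s -> P l s) ->
  (forall l, (l < L)%nat -> exists r, 0 <= r /\ P l r) ->
  exists r, 0 <= r /\ forall l, (l < L)%nat -> P l r.
Proof.
  intros Hmono. induction L as [|L IH]; intros H.
  - exists 0. split; [lra|lia].
  - destruct IH as [r [Hr Hall]]; [intros; apply H; lia|].
    destruct (H L) as [s [Hs HL]]; [lia|].
    exists (Rmax r s). split; [eapply Rle_trans; [exact Hr|apply Rmax_l]|].
    intros l Hl. destruct (Nat.eq_dec l L) as [->|Hne].
    + apply Hmono with s; [exact HL|apply Rmax_r].
    + apply Hmono with r; [apply Hall; lia|apply Rmax_l].
Qed.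

(** * The penalised cost *)

Section Network.

Context {Y : Type}.
Variables (L d0 dL : nat) (D : list ((nat -> R) * Y)).
Variables (sigma : nat -> R -> R) (e : (nat -> R) -> Y -> R) (lam p : R) (b : bool).
Hypothesis HL : (0 < L)%nat.
Hypothesis Hlam : 0 < lam.
Hypothesis Hp : 1 <= p.
Hypothesis sigma0 : forall l, (1 <= l <= L)%nat -> sigma l 0 = 0.
Hypothesis sigma_lip : forall l, (1 <= l <= L)%nat -> loc_lipschitz (sigma l).
Hypothesis e_nonneg : forall v y, is_vec dL v -> 0 <= e v y.
(** [G] depends on the error level alone, which makes it uniform in the widths; [delta] may vary
    with the point and the label. *)
Hypothesis e_lip : forall S, 0 <= S -> exists G, 0 <= G /\
  forall v y, is_vec dL v -> e v y <= S -> exists delta, 0 < delta /\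
    forall w, is_vec dL w -> supnorm dL (fun i => w i - v i) < delta ->
      Rabs (e w y - e v y) <= G * supnorm dL (fun i => w i - v i).

Definition reg (d : nat -> nat) (W : nat -> nat -> nat -> R) : R :=
  sumR L (fun k => lpen p b (d k) (d (S k)) (W (S k))).

Definition cost (d : nat -> nat) (W : nat -> nat -> nat -> R) : R :=
  mean D (fun xy => e (net L sigma d W (fst xy)) (snd xy)) + lam * reg d W.

(** The value $z_{k+1}$ at unit [j]: the index [k] is that of the layer feeding it. *)
Definition pre (d : nat -> nat) (W : nat -> nat -> nat -> R) (x : nat -> R) (k j : nat) : R :=
  sumR (d k) (fun i => fwd sigma d W x k i * W (S k) i j).

Lemma fwd_S d W x k j : fwd sigma d W x (S k) j = sigma (S k) (pre d W x k j).
Proof. reflexivity. Qed.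

Lemma net_is_vec d W x : d L = dL -> is_vec dL (net L sigma d W x).
Proof.
  intros Hd i Hi. unfold net. rewrite Hd. destruct (Nat.ltb_spec i dL); [lia|reflexivity].
Qed.

Lemma error_nonneg d W xy : d L = dL -> 0 <= e (net L sigma d W (fst xy)) (snd xy).
Proof. intros Hd. now apply e_nonneg, net_is_vec. Qed.

(** [e] takes a function, so networks must be equal as functions; cutting [net] off to 0 beyond the
    output width makes this possible. *)
Lemma net_ext d W d' W' x :
  d L = d' L -> (forall j, (j < d L)%nat -> fwd sigma d' W' x L j = fwd sigma d W x L j) ->
  net L sigma d' W' x = net L sigma d W x.
Proof.
  intros Hd H. apply functional_extensionality. intros j. unfold net. rewrite <- Hd.
  destruct (Nat.ltb_spec j (d L)); auto.
Qed.

Lemma reg_nonneg d W : 0 <= reg d W.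
Proof. apply sumR_nonneg. intros. apply lpen_nonneg. Qed.

Lemma cost_nonneg d W : d L = dL -> 0 <= cost d W.
Proof.
  intros Hd. unfold cost. apply Rplus_le_le_0_compat.
  - apply mean_nonneg. intros. now apply error_nonneg.
  - apply Rmult_le_pos; [lra|apply reg_nonneg].
Qed.

Definition cost0 : R := mean D (fun xy => e (fun _ => 0) (snd xy)).

(** The last preactivation vanishes and [sigma0] keeps it at 0, whatever the widths. *)
Lemma cost_zero_weights d : cost d (fun _ _ _ => 0) = cost0.
Proof.
  unfold cost, reg. rewrite sumR_eq0 by (intros; now apply lpen_eq0).
  rewrite Rmult_0_r, Rplus_0_r. apply mean_ext. intros xy _. f_equal.
  apply functional_extensionality. intros j. unfold net.
  destruct (Nat.ltb j (d L)); [|reflexivity].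
  destruct L as [|k]; [lia|]. rewrite fwd_S. unfold pre.
  rewrite sumR_eq0 by (intros; ring). apply sigma0. lia.
Qed.

(** Errors and penalties are nonnegative, so no single summand exceeds the cost. *)
Lemma lpen_le_cost d W C k :
  d L = dL -> cost d W <= C -> (k < L)%nat ->
  lpen p b (d k) (d (S k)) (W (S k)) <= C / lam.
Proof.
  intros Hd HC Hk. apply Rmult_le_reg_l with (1 := Hlam).
  replace (lam * (C / lam)) with C by (field; lra).
  apply Rle_trans with (lam * reg d W).
  - apply Rmult_le_compat_l; [lra|].
    apply (sumR_term_le L (fun k => lpen p b (d k) (d (S k)) (W (S k)))); [|exact Hk].
    intros. apply lpen_nonneg.
  - unfold cost in HC.
    pose proof (mean_nonneg D _ (fun xy _ => error_nonneg d W xy Hd)). lra.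
Qed.

Lemma error_le_cost d W C xy :
  d L = dL -> cost d W <= C -> In xy D ->
  e (net L sigma d W (fst xy)) (snd xy) <= INR (length D) * C.
Proof.
  intros Hd HC Hxy.
  eapply Rle_trans;
    [apply (term_le_mean D (fun xy => e (net L sigma d W (fst xy)) (snd xy)))|].
  - intros. now apply error_nonneg.
  - exact Hxy.
  - apply Rmult_le_compat_l; [apply pos_INR|].
    unfold cost in HC. pose proof (reg_nonneg d W). nra.
Qed.

(** * Bounds independent of the widths *)

Definition lipschitz_layers (S Q : R) : Prop :=
  forall l, (1 <= l <= L)%nat -> forall s t, Rabs s <= S -> Rabs t <= S ->
    Rabs (sigma l s - sigma l t) <= Q * Rabs (s - t).

Lemma lipschitz_layers_exists S :
  0 <= S -> exists Q, 0 <= Q /\ lipschitz_layers S Q.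
Proof.
  intros HS.
  (* Layers are counted from 0 here; [Datatypes.S] is the successor, since [S] names the radius. *)
  destruct (nat_uniform_upper L (fun k Q => forall s t, Rabs s <= S -> Rabs t <= S ->
    Rabs (sigma (Datatypes.S k) s - sigma (Datatypes.S k) t) <= Q * Rabs (s - t)))
    as [Q [HQ H]].
  - intros k r r' H Hr s t Hs Ht. eapply Rle_trans; [now apply H|].
    apply Rmult_le_compat_r; [apply Rabs_pos|exact Hr].
  - intros k Hk. apply sigma_lip; [lia|exact HS].
  - exists Q. split; [exact HQ|]. intros [|k] Hl; [lia|]. apply H. lia.
Qed.

Lemma sigma_le_lipschitz S Q l s :
  lipschitz_layers S Q -> (1 <= l <= L)%nat -> Rabs s <= S ->
  Rabs (sigma l s) <= Q * Rabs s.
Proof.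
  intros HQ Hl Hs.
  replace (sigma l s) with (sigma l s - sigma l 0) by (rewrite sigma0 by exact Hl; ring).
  replace s with (s - 0) at 2 by ring. apply HQ; [exact Hl|exact Hs|].
  rewrite Rabs_R0. pose proof (Rabs_pos s). lra.
Qed.

(** If a layer has norm at most [A], the next preactivation has norm at most [A * B], and a
    Lipschitz constant [Q] on that radius bounds the next layer by [Q * (A * B)]. All constants are
    chosen before [d] and [W]. *)
Lemma activation_bound B X :
  0 <= B -> 0 <= X -> exists A, 0 <= A /\ forall d W x, d 0%nat = d0 -> nu b d0 x <= X ->
    (forall k, (k < L)%nat -> lpen p b (d k) (d (S k)) (W (S k)) <= B) ->
    forall k, (k <= L)%nat -> nu b (d k) (fwd sigma d W x k) <= A.
Proof.
  intros HB HX.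
  enough (Hk : forall K, (K <= L)%nat ->
    exists A, 0 <= A /\ forall d W x, d 0%nat = d0 -> nu b d0 x <= X ->
    (forall k, (k < L)%nat -> lpen p b (d k) (d (S k)) (W (S k)) <= B) ->
    forall k, (k <= K)%nat -> nu b (d k) (fwd sigma d W x k) <= A) by now apply Hk.
  induction K as [|K IH]; intros HK.
  - exists X. split; [exact HX|]. intros d W x Hd Hx _ k Hk.
    replace k with 0%nat by lia. now rewrite Hd.
  - destruct IH as [A [HA H]]; [lia|].
    assert (HAB : 0 <= A * B) by now apply Rmult_le_pos.
    destruct (lipschitz_layers_exists (A * B) HAB) as [Q [HQ HLip]].
    exists (Rmax A (Q * (A * B))). split; [eapply Rle_trans; [exact HA|apply Rmax_l]|].
    intros d W x Hd Hx HW k Hk. destruct (Nat.eq_dec k (S K)) as [->|Hne].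
    + assert (Hpre : nu b (d (S K)) (pre d W x K) <= A * B).
      { eapply Rle_trans; [apply nu_mulmx; exact Hp|].
        apply Rmult_le_compat; [apply nu_nonneg|apply lpen_nonneg| |apply HW; lia].
        apply H; auto. }
      eapply Rle_trans; [|apply Rmax_r].
      apply Rle_trans with (Q * nu b (d (S K)) (pre d W x K));
        [|now apply Rmult_le_compat_l].
      apply nu_le; [exact HQ|]. intros j Hj. rewrite fwd_S.
      apply (sigma_le_lipschitz (A * B)); [exact HLip|lia|].
      eapply Rle_trans; [apply (entry_le_nu b); exact Hj|exact Hpre].
    + eapply Rle_trans; [apply H; auto; lia|apply Rmax_l].
Qed.

Definition bounded_run A B d W x : Prop :=
  (forall k, (k < L)%nat -> lpen p b (d k) (d (S k)) (W (S k)) <= B) /\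
  (forall k, (k <= L)%nat -> nu b (d k) (fwd sigma d W x k) <= A).

Lemma pre_bound A B d W x k j :
  0 <= A -> 0 <= B -> bounded_run A B d W x -> (k < L)%nat -> (j < d (S k))%nat ->
  Rabs (pre d W x k j) <= A * B.
Proof.
  intros HA HB [HW Hx] Hk Hj.
  eapply Rle_trans; [apply (entry_le_nu b); exact Hj|].
  eapply Rle_trans; [apply nu_mulmx; exact Hp|].
  apply Rmult_le_compat; [apply nu_nonneg|apply lpen_nonneg| |now apply HW].
  apply Hx. lia.
Qed.

(** Each later layer multiplies the change by at most [Q * B]. The base [Q * B + 1] is at least 1,
    so the exponent can afterwards be raised to [L]. *)
Lemma perturbation_propagates A B Q d W W' x k1 delta r :
  0 <= A -> 0 <= B -> 0 <= Q -> lipschitz_layers (A * B) Q ->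
  bounded_run A B d W x -> bounded_run A B d W' x ->
  (forall q, (k1 < q)%nat -> W' (S q) = W (S q)) ->
  nu b (d (S k1)) (fun j => pre d W' x k1 j - pre d W x k1 j) <= delta ->
  (k1 + r < L)%nat ->
  nu b (d (S (k1 + r)))
    (fun j => fwd sigma d W' x (S (k1 + r)) j - fwd sigma d W x (S (k1 + r)) j)
    <= Q * (Q * B + 1) ^ r * delta.
Proof.
  intros HA HB HQ HLip HR HR' HW Hdelta.
  assert (Hstep : forall k, (k < L)%nat ->
    nu b (d (S k)) (fun j => fwd sigma d W' x (S k) j - fwd sigma d W x (S k) j)
      <= Q * nu b (d (S k)) (fun j => pre d W' x k j - pre d W x k j)).
  { intros k Hk. apply nu_le; [exact HQ|]. intros j Hj. rewrite !fwd_S.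
    apply HLip; [lia| |]; now apply pre_bound. }
  assert (HQB : 0 <= Q * B) by now apply Rmult_le_pos.
  assert (Hd0 : 0 <= delta) by (eapply Rle_trans; [apply nu_nonneg|exact Hdelta]).
  induction r as [|r IH]; intros Hr.
  - rewrite Nat.add_0_r, pow_O, Rmult_1_r.
    eapply Rle_trans; [apply Hstep; lia|]. now apply Rmult_le_compat_l.
  - rewrite Nat.add_succ_r. eapply Rle_trans; [apply Hstep; lia|].
    rewrite Rmult_assoc. apply Rmult_le_compat_l; [exact HQ|].
    set (k := (k1 + r)%nat) in *.
    (* The weights agree from here on, so the change of the preactivation is linear in the change of
       the activation. *)
    rewrite (nu_ext b _ _ (fun j => sumR (d (S k)) (fun i =>
      (fwd sigma d W' x (S k) i - fwd sigma d W x (S k) i) * W (S (S k)) i j))).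
    + eapply Rle_trans; [apply nu_mulmx; exact Hp|].
      apply Rle_trans with (Q * (Q * B + 1) ^ r * delta * B).
      * apply Rmult_le_compat; [apply nu_nonneg|apply lpen_nonneg| |apply HR; lia].
        apply IH. lia.
      * simpl. assert (0 <= (Q * B + 1) ^ r * delta).
        { apply Rmult_le_pos; [apply pow_le; lra|exact Hd0]. }
        nra.
    + intros j Hj. unfold pre. rewrite HW by lia.
      replace (sumR (d (S k)) (fun i => fwd sigma d W' x (S k) i * W (S (S k)) i j))
        with (sumR (d (S k)) (fun i =>
          (fwd sigma d W' x (S k) i - fwd sigma d W x (S k) i) * W (S (S k)) i j
          + fwd sigma d W x (S k) i * W (S (S k)) i j))
        by (apply sumR_ext; intros; ring).
      rewrite sumR_plus. ring.
Qed.

(** * Stationarity of a minimiser *)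

(* For unit [j] of layer [k + 1]: [unit_pen] is the norm of its penalised side
   (fan-in or fan-out), [unit_other] the l1 norm of the other side, and [shrink]
   scales the penalised side by [1 - t]. *)
Definition unit_pen (d : nat -> nat) (W : nat -> nat -> nat -> R) (k j : nat) : R :=
  if b then pnorm (d k) p (fun i => W (S k) i j)
  else pnorm (d (S (S k))) p (fun m => W (S (S k)) j m).

Definition unit_other (d : nat -> nat) (W : nat -> nat -> nat -> R) (k j : nat) : R :=
  if b then sumR (d (S (S k))) (fun m => Rabs (W (S (S k)) j m))
  else sumR (d k) (fun i => Rabs (W (S k) i j)).

Definition shrink (k j : nat) (t : R) (W : nat -> nat -> nat -> R) : nat -> nat -> nat -> R :=
  fun q i m =>
    if (if b then Nat.eqb q (S k) && Nat.eqb m j else Nat.eqb q (S (S k)) && Nat.eqb i j)%bool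
    then (1 - t) * W q i m else W q i m.

(** The matrix altered by [shrink k j] is [W (S (shrunk_layer k))]; activations up to index
    [shrunk_layer k] do not see it. *)
Definition shrunk_layer (k : nat) : nat := if b then k else S k.

Lemma unit_pen_nonneg d W k j : 0 <= unit_pen d W k j.
Proof. unfold unit_pen. destruct b; apply pnorm_nonneg. Qed.

Lemma unit_other_nonneg d W k j : 0 <= unit_other d W k j.
Proof.
  unfold unit_other. destruct b; apply sumR_nonneg; intros; apply Rabs_pos.
Qed.

Lemma shrink_other_layer k j t W q :
  q <> shrunk_layer k -> shrink k j t W (S q) = W (S q).
Proof.
  intros Hq. apply functional_extensionality. intros i.
  apply functional_extensionality. intros m. unfold shrink, shrunk_layer in *.
  destruct b; simpl.
  - destruct (Nat.eqb_spec q k); [lia|reflexivity].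
  - destruct (Nat.eqb_spec q (S k)); [lia|reflexivity].
Qed.

Lemma lpen_shrunk_layer d W k j t :
  (j < d (S k))%nat -> t <= 1 ->
  lpen p b (d (shrunk_layer k)) (d (S (shrunk_layer k))) (shrink k j t W (S (shrunk_layer k)))
  = lpen p b (d (shrunk_layer k)) (d (S (shrunk_layer k))) (W (S (shrunk_layer k)))
    - t * unit_pen d W k j.
Proof.
  intros Hj Ht. unfold lpen, unit_pen, shrunk_layer, shrink. destruct b.
  - apply (colpen_shrink p Hp (d k) (d (S k)) (W (S k))); [exact Hj|exact Ht| |].
    + intros i m _ _ Hm. rewrite Nat.eqb_refl. simpl.
      destruct (Nat.eqb_spec m j); [lia|reflexivity].
    + intros i _. now rewrite !Nat.eqb_refl.
  - apply (colpen_shrink p Hp (d (S (S k))) (d (S k)) (fun i m => W (S (S k)) m i));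
      [exact Hj|exact Ht| |].
    + intros i m _ _ Hm. rewrite Nat.eqb_refl. simpl.
      destruct (Nat.eqb_spec m j); [lia|reflexivity].
    + intros i _. now rewrite !Nat.eqb_refl.
Qed.

Lemma reg_shrink d W k j t :
  (S k < L)%nat -> (j < d (S k))%nat -> t <= 1 ->
  reg d (shrink k j t W) = reg d W - t * unit_pen d W k j.
Proof.
  intros Hk Hj Ht. unfold reg.
  rewrite (sumR_update L (shrunk_layer k) _
             (fun q => lpen p b (d q) (d (S q)) (W (S q)))).
  - rewrite lpen_shrunk_layer by assumption. ring.
  - unfold shrunk_layer. destruct b; lia.
  - intros q _ Hq. now rewrite shrink_other_layer.
Qed.

Lemma lpen_shrink_le d W k j t q :
  (j < d (S k))%nat -> 0 <= t <= 1 ->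
  lpen p b (d q) (d (S q)) (shrink k j t W (S q)) <= lpen p b (d q) (d (S q)) (W (S q)).
Proof.
  intros Hj Ht. destruct (Nat.eq_dec q (shrunk_layer k)) as [->|Hq].
  - rewrite lpen_shrunk_layer by (try assumption; lra).
    pose proof (unit_pen_nonneg d W k j). nra.
  - rewrite shrink_other_layer by exact Hq. lra.
Qed.

Lemma fwd_shrink d W k j t x q :
  (q <= shrunk_layer k)%nat -> fwd sigma d (shrink k j t W) x q = fwd sigma d W x q.
Proof.
  induction q as [|q IH]; intros Hq; [reflexivity|].
  simpl. rewrite IH by lia. now rewrite shrink_other_layer by lia.
Qed.

(** In both cases the change at the following layer is first order in [t] and a product of the two
    sides of the unit: one side enters through the output of the unit, the other through its
    outgoing weights. *)
Lemma pre_shrink_bound A B Q d W k j t x :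
  0 <= A -> 0 <= B -> 0 <= Q -> lipschitz_layers (A * B) Q ->
  (S k < L)%nat -> (j < d (S k))%nat -> 0 <= t <= 1 ->
  bounded_run A B d W x -> bounded_run A B d (shrink k j t W) x ->
  nu b (d (S (S k))) (fun m => pre d (shrink k j t W) x (S k) m - pre d W x (S k) m)
    <= t * (Q * A) * unit_pen d W k j * unit_other d W k j.
Proof.
  intros HA HB HQ HLip Hk Hj Ht HR HR'.
  pose proof (fwd_shrink d W k j t x) as Hfwd.
  pose proof (shrink_other_layer k j t W) as Hoth.
  pose proof (pre_bound A B d W x k j HA HB HR ltac:(lia) Hj) as Hpre.
  pose proof (pre_bound A B d (shrink k j t W) x k j HA HB HR' ltac:(lia) Hj) as Hpre'.
  assert (Hxk : nu b (d k) (fwd sigma d W x k) <= A) by (apply HR; lia).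
  clear HR HR'. unfold unit_pen, unit_other, shrunk_layer in *.
  set (W' := shrink k j t W) in *.
  destruct b eqn:Eb; simpl nu in *.
  - (* only the output of unit [j] changes, and it acts through its fan-out *)
    set (P := pnorm (d k) p (fun i => W (S k) i j)).
    assert (HP : 0 <= P) by apply pnorm_nonneg.
    assert (Hsame : forall m, m <> j -> fwd sigma d W' x (S k) m = fwd sigma d W x (S k) m).
    { intros m Hm. rewrite !fwd_S. unfold pre. rewrite Hfwd by lia. f_equal.
      apply sumR_ext. intros i _. f_equal. unfold W', shrink. rewrite Eb, Nat.eqb_refl.
      destruct (Nat.eqb_spec m j); [lia|reflexivity]. }
    assert (Hprej : pre d W' x k j = (1 - t) * pre d W x k j).
    { unfold pre. rewrite Hfwd, <- sumR_scal by lia. apply sumR_ext. intros i _.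
      unfold W', shrink. rewrite Eb, !Nat.eqb_refl. simpl. ring. }
    assert (Hj' : Rabs (fwd sigma d W' x (S k) j - fwd sigma d W x (S k) j) <= t * (Q * A) * P).
    { rewrite !fwd_S. eapply Rle_trans; [apply HLip; [lia|exact Hpre'|exact Hpre]|].
      rewrite Hprej.
      replace ((1 - t) * pre d W x k j - pre d W x k j) with (- t * pre d W x k j) by ring.
      rewrite Rabs_mult, Rabs_Ropp, (Rabs_pos_eq t) by lra.
      replace (t * (Q * A) * P) with (Q * (t * (A * P))) by ring.
      apply Rmult_le_compat_l; [exact HQ|]. apply Rmult_le_compat_l; [lra|].
      apply Rle_trans with (nu true (d k) (fwd sigma d W x k) * P);
        [|now apply Rmult_le_compat_r].
      apply (Rabs_dot_le_l1 (d k) (fwd sigma d W x k) (fun i => W (S k) i j)).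
      intros i Hi. now apply (entry_le_pnorm p Hp (d k) (fun i => W (S k) i j)). }
    rewrite <- sumR_scal. apply sumR_le. intros m Hm.
    unfold pre. rewrite Hoth by lia.
    rewrite (sumR_update (d (S k)) j (fun i => fwd sigma d W' x (S k) i * W (S (S k)) i m)
               (fun i => fwd sigma d W x (S k) i * W (S (S k)) i m) Hj)
      by (intros i _ Hi; now rewrite Hsame).
    match goal with |- Rabs ?z <= _ =>
      replace z with ((fwd sigma d W' x (S k) j - fwd sigma d W x (S k) j) * W (S (S k)) j m)
        by ring end.
    rewrite Rabs_mult. apply Rmult_le_compat_r; [apply Rabs_pos|exact Hj'].
  (* Fan-out: the output of unit [j] is unchanged and at most [Q * A * T]; only its outgoing weights
     move, each by [t] times its size. *)
  - set (T := sumR (d k) (fun i => Rabs (W (S k) i j))).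
    assert (HT : 0 <= T) by (apply sumR_nonneg; intros; apply Rabs_pos).
    assert (Hxj : Rabs (fwd sigma d W x (S k) j) <= Q * A * T).
    { rewrite fwd_S.
      eapply Rle_trans; [apply (sigma_le_lipschitz _ _ _ _ HLip); [lia|exact Hpre]|].
      rewrite Rmult_assoc. apply Rmult_le_compat_l; [exact HQ|]. rewrite Rmult_comm.
      unfold pre. rewrite (sumR_ext (d k) _ (fun i => W (S k) i j * fwd sigma d W x k i))
        by (intros; ring).
      apply (Rabs_dot_le_l1 (d k) (fun i => W (S k) i j)). intros i Hi.
      eapply Rle_trans; [apply supnorm_ge; exact Hi|exact Hxk]. }
    assert (HQA : 0 <= Q * A) by now apply Rmult_le_pos.
    pose proof (pnorm_nonneg p (d (S (S k))) (fun m => W (S (S k)) j m)) as HP.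
    set (P := pnorm (d (S (S k))) p (fun m => W (S (S k)) j m)) in *.
    apply supnorm_lub.
    + repeat apply Rmult_le_pos; lra.
    + intros m Hm. unfold pre. rewrite Hfwd by lia.
      rewrite (sumR_update (d (S k)) j (fun i => fwd sigma d W x (S k) i * W' (S (S k)) i m)
               (fun i => fwd sigma d W x (S k) i * W (S (S k)) i m) Hj).
      * replace (W' (S (S k)) j m) with ((1 - t) * W (S (S k)) j m)
          by (unfold W', shrink; now rewrite Eb, !Nat.eqb_refl).
        match goal with |- Rabs ?z <= _ =>
          replace z with (- t * (fwd sigma d W x (S k) j * W (S (S k)) j m)) by ring end.
        rewrite !Rabs_mult, Rabs_Ropp, (Rabs_pos_eq t) by lra.
        replace (t * (Q * A) * P * T) with (t * (Q * A * T * P)) by ring.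
        apply Rmult_le_compat_l; [lra|].
        apply Rmult_le_compat; try apply Rabs_pos; [exact Hxj|].
        now apply (entry_le_pnorm p Hp (d (S (S k))) (fun m => W (S (S k)) j m)).
      * intros i _ Hi. f_equal. unfold W', shrink. rewrite Eb, Nat.eqb_refl.
        destruct (Nat.eqb_spec i j); [lia|reflexivity].
Qed.

Lemma net_shrink_bound A B Q d W k j t x :
  0 <= A -> 0 <= B -> 0 <= Q -> lipschitz_layers (A * B) Q -> d L = dL ->
  (S k < L)%nat -> (j < d (S k))%nat -> 0 <= t <= 1 ->
  bounded_run A B d W x -> bounded_run A B d (shrink k j t W) x ->
  supnorm dL (fun i => net L sigma d (shrink k j t W) x i - net L sigma d W x i)
    <= Q * (Q * B + 1) ^ L * (Q * A) * (t * (unit_pen d W k j * unit_other d W k j)).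
Proof.
  intros HA HB HQ HLip Hd Hk Hj Ht HR HR'.
  pose proof (unit_pen_nonneg d W k j) as HP. pose proof (unit_other_nonneg d W k j) as HT.
  set (delta := t * (Q * A) * unit_pen d W k j * unit_other d W k j).
  assert (HQA : 0 <= Q * A) by now apply Rmult_le_pos.
  assert (Hdelta : 0 <= delta) by (unfold delta; repeat apply Rmult_le_pos; lra).
  assert (HQB : 0 <= Q * B) by now apply Rmult_le_pos.
  pose proof (pow_le (Q * B + 1) L ltac:(lra)) as HpowL.
  replace (Q * (Q * B + 1) ^ L * (Q * A) * (t * (unit_pen d W k j * unit_other d W k j)))
    with (Q * (Q * B + 1) ^ L * delta) by (unfold delta; ring).
  apply supnorm_lub; [repeat apply Rmult_le_pos; lra|].
  intros i Hi. unfold net. rewrite Hd. destruct (Nat.ltb_spec i dL); [|lia].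
  (* The change starts in the preactivation of layer [S (S k)], which leaves [L - S (S k)] further
     layers. *)
  pose proof (perturbation_propagates A B Q d W (shrink k j t W) x (S k) delta (L - S (S k))
    HA HB HQ HLip HR HR') as Hprop.
  replace (S (S k + (L - S (S k)))) with L in Hprop by lia. rewrite Hd in Hprop.
  apply Rle_trans with (Q * (Q * B + 1) ^ (L - S (S k)) * delta).
  - eapply Rle_trans;
      [apply (entry_le_nu b dL (fun j' => fwd sigma d (shrink k j t W) x L j'
                                         - fwd sigma d W x L j')); exact Hi|].
    apply Hprop; [|now apply (pre_shrink_bound A B)|lia].
    intros q Hq. apply shrink_other_layer. unfold shrunk_layer. destruct b; lia.
  - apply Rmult_le_compat_r; [exact Hdelta|]. apply Rmult_le_compat_l; [exact HQ|].
    apply Rle_pow; [lra|lia].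
Qed.

Definition minimiser d W : Prop := forall W', cost d W <= cost d W'.

(* Shrinking the penalised side of a unit saves [t * lam * unit_pen] and costs at most
   [O(t) * unit_pen * unit_other], with a constant independent of the widths. *)
Lemma minimiser_unit_alternative :
  exists B c, 0 <= B /\ 0 < c /\ forall d W, d 0%nat = d0 -> d L = dL -> minimiser d W ->
    (forall k, (k < L)%nat -> lpen p b (d k) (d (S k)) (W (S k)) <= B) /\
    forall k j, (S k < L)%nat -> (j < d (S k))%nat ->
      unit_pen d W k j = 0 \/ c <= unit_other d W k j.
Proof.
  assert (H0 : 0 <= cost0).
  { apply mean_nonneg. intros. apply e_nonneg. now intros i _. }
  set (B := cost0 / lam).
  assert (HB : 0 <= B).
  { apply Rmult_le_pos; [exact H0|]. left. now apply Rinv_0_lt_compat. }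
  destruct (list_uniform_upper D (fun xy => nu b d0 (fst xy))) as [X [HX HDX]].
  destruct (activation_bound B X HB HX) as [A [HA Hact]].
  assert (HAB : 0 <= A * B) by now apply Rmult_le_pos.
  destruct (lipschitz_layers_exists (A * B) HAB) as [Q [HQ HLip]].
  (* A single error is at most the sum of all errors, which is [INR (length D)] times their mean. *)
  destruct (e_lip (INR (length D) * cost0)) as [G [HG Hloc]].
  { apply Rmult_le_pos; [apply pos_INR|exact H0]. }
  set (K := Q * (Q * B + 1) ^ L * (Q * A)).
  assert (HQB : 0 <= Q * B) by now apply Rmult_le_pos.
  assert (HQA : 0 <= Q * A) by now apply Rmult_le_pos.
  assert (HK : 0 <= K).
  { unfold K. pose proof (pow_le (Q * B + 1) L ltac:(lra)).
    repeat apply Rmult_le_pos; lra. }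
  assert (HGK : 0 <= G * K) by now apply Rmult_le_pos.
  (* The summand 1 keeps the denominator positive when [G * K = 0]. *)
  exists B, (lam / (G * K + 1)). split; [exact HB|]. split.
  { apply Rdiv_lt_0_compat; lra. }
  intros d W Hd0 HdL Hmin.
  assert (HC : cost d W <= cost0) by (rewrite <- (cost_zero_weights d); apply Hmin).
  assert (HW : forall k, (k < L)%nat -> lpen p b (d k) (d (S k)) (W (S k)) <= B).
  { intros k Hk. now apply lpen_le_cost. }
  split; [exact HW|]. intros k j Hk Hj.
  pose proof (unit_pen_nonneg d W k j) as HP. pose proof (unit_other_nonneg d W k j) as HT.
  set (P := unit_pen d W k j) in *. set (T := unit_other d W k j) in *.
  destruct HP as [HP|HP]; [right|left; now rewrite <- HP].
  assert (HPT : 0 <= P * T) by (apply Rmult_le_pos; lra).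
  (* This [delta] depends on [W] and the widths, but it only limits the size of [t] and does not
     enter [c]. *)
  destruct (list_uniform_radius D (fun xy delta =>
      forall w, is_vec dL w ->
        supnorm dL (fun i => w i - net L sigma d W (fst xy) i) < delta ->
        Rabs (e w (snd xy) - e (net L sigma d W (fst xy)) (snd xy))
          <= G * supnorm dL (fun i => w i - net L sigma d W (fst xy) i)))
    as [delta [Hdelta HD]].
  { intros xy r s H Hs w Hw Hlt. apply H; [exact Hw|lra]. }
  { intros xy Hxy. apply Hloc; [now apply net_is_vec|]. now apply error_le_cost. }
  assert (HKPT : 0 <= K * (P * T)) by now apply Rmult_le_pos.
  assert (Hquot : 0 < delta / (K * (P * T) + 1)) by (apply Rdiv_lt_0_compat; lra).
  set (t := Rmin 1 (delta / (K * (P * T) + 1))).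
  assert (Ht : 0 < t <= 1) by (split; [apply Rmin_glb_lt; lra|apply Rmin_l]).
  assert (Hsmall : K * (t * (P * T)) < delta).
  { apply Rlt_le_trans with (t * (K * (P * T) + 1)); [lra|].
    apply Rle_trans with (delta / (K * (P * T) + 1) * (K * (P * T) + 1));
      [|right; field; lra].
    apply Rmult_le_compat_r; [lra|apply Rmin_r]. }
  assert (Hrun : forall V x, In x (map fst D) ->
    (forall k, (k < L)%nat -> lpen p b (d k) (d (S k)) (V (S k)) <= B) ->
    bounded_run A B d V x).
  { intros V x Hx HV. split; [exact HV|]. apply Hact; [exact Hd0| |exact HV].
    apply in_map_iff in Hx. destruct Hx as [xy [<- Hxy]]. now apply HDX. }
  assert (HW' : forall q, (q < L)%nat ->
    lpen p b (d q) (d (S q)) (shrink k j t W (S q)) <= B).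
  { intros q Hq. eapply Rle_trans; [apply lpen_shrink_le; [exact Hj|lra]|now apply HW]. }
  assert (Hmean : mean D (fun xy => e (net L sigma d (shrink k j t W) (fst xy)) (snd xy))
    <= mean D (fun xy => e (net L sigma d W (fst xy)) (snd xy)) + G * (K * (t * (P * T)))).
  { apply mean_le_plus.
    - apply Rmult_le_pos; [exact HG|]. apply Rmult_le_pos; [exact HK|].
      apply Rmult_le_pos; [lra|exact HPT].
    - intros xy Hxy. pose proof (in_map fst D xy Hxy) as Hx.
      assert (Hnet : supnorm dL (fun i => net L sigma d (shrink k j t W) (fst xy) i
                                         - net L sigma d W (fst xy) i) <= K * (t * (P * T))).
      { apply net_shrink_bound; auto. lra. }
      pose proof (HD xy Hxy _ (net_is_vec d (shrink k j t W) (fst xy) HdL)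
                    ltac:(eapply Rle_lt_trans; [exact Hnet|exact Hsmall])) as He.
      apply Rabs_le_between in He.
      apply (Rmult_le_compat_l G) in Hnet; [|exact HG]. lra. }
  (* By minimality the saving [lam * (t * P)] is at most the loss [G * K * T * (t * P)]; dividing by
     [t * P] bounds [T] below. *)
  pose proof (Hmin (shrink k j t W)) as Hopt. unfold cost in Hopt.
  rewrite reg_shrink in Hopt by (try assumption; lra). fold P in Hopt.
  assert (Hineq : lam * (t * P) <= G * K * T * (t * P)) by lra.
  apply Rmult_le_reg_r in Hineq; [|apply Rmult_lt_0_compat; lra].
  apply Rmult_le_reg_r with (G * K + 1); [lra|].
  replace (lam / (G * K + 1) * (G * K + 1)) with lam by (field; lra). nra.
Qed.

(** * Minimisers at fixed widths *)

(** Continuity of [e] at [w], from [e_lip] at the level [e w y] and a squeeze by the l1 distance. *)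
Lemma is_lim_seq_error (v : nat -> nat -> R) (w : nat -> R) y :
  (forall n, is_vec dL (v n)) -> is_vec dL w ->
  (forall j, (j < dL)%nat -> is_lim_seq (fun n => v n j) (w j)) ->
  is_lim_seq (fun n => e (v n) y) (e w y).
Proof.
  intros Hv Hw Hlim.
  destruct (e_lip (e w y) (e_nonneg w y Hw)) as [G [HG Hloc]].
  destruct (Hloc w y Hw (Rle_refl _)) as [delta [Hdelta He]].
  set (s := fun n => sumR dL (fun j => Rabs (v n j - w j))).
  assert (Hs : is_lim_seq s 0).
  { rewrite <- (sumR_eq0 dL (fun _ => 0)) by reflexivity.
    apply (is_lim_seq_sumR dL (fun n j => Rabs (v n j - w j)) (fun _ => 0)).
    intros j Hj. apply (is_lim_seq_abs_0 (fun n => v n j - w j)).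
    replace (Finite 0) with (Finite (w j - w j)) by (f_equal; ring).
    apply is_lim_seq_minus'; [now apply Hlim|apply is_lim_seq_const]. }
  assert (Hsup : forall n, supnorm dL (fun j => v n j - w j) <= s n).
  { intros n. apply supnorm_lub.
    - apply sumR_nonneg. intros. apply Rabs_pos.
    - intros j Hj. apply (sumR_term_le dL (fun j => Rabs (v n j - w j))); [|exact Hj].
      intros. apply Rabs_pos. }
  assert (HGs : is_lim_seq (fun n => G * s n) 0).
  { replace (Finite 0) with (Rbar_mult G 0) by (simpl; f_equal; ring).
    now apply is_lim_seq_scal_l. }
  apply (is_lim_seq_le_le_loc (fun n => e w y - G * s n) _ (fun n => e w y + G * s n)).
  - apply is_lim_seq_spec in Hs. generalize (Hs (mkposreal _ Hdelta)).
    apply filter_imp. simpl. intros n Hn. rewrite Rminus_0_r in Hn. apply Rabs_def2 in Hn.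
    pose proof (Hsup n) as Hle.
    assert (Hb : Rabs (e (v n) y - e w y) <= G * supnorm dL (fun j => v n j - w j))
      by (apply He; [apply Hv|lra]).
    apply (Rmult_le_compat_l G) in Hle; [|exact HG].
    apply Rabs_le_between in Hb. lra.
  - replace (Finite (e w y)) with (Finite (e w y - 0)) by (f_equal; ring).
    apply is_lim_seq_minus'; [apply is_lim_seq_const|exact HGs].
  - replace (Finite (e w y)) with (Finite (e w y + 0)) by (f_equal; ring).
    apply is_lim_seq_plus'; [apply is_lim_seq_const|exact HGs].
Qed.

Lemma is_lim_seq_fwd d (V : nat -> nat -> nat -> nat -> R) (W : nat -> nat -> nat -> R) x :
  (forall k i j, (k < L)%nat -> (i < d k)%nat -> (j < d (S k))%nat ->
     is_lim_seq (fun n => V n (S k) i j) (W (S k) i j)) ->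
  forall k j, (k <= L)%nat -> (j < d k)%nat ->
    is_lim_seq (fun n => fwd sigma d (V n) x k j) (fwd sigma d W x k j).
Proof.
  intros H k. induction k as [|k IH]; intros j Hk Hj; [apply is_lim_seq_const|].
  simpl. apply (is_lim_seq_loc_lipschitz (sigma (S k))); [apply sigma_lip; lia|].
  apply (is_lim_seq_sumR (d k) (fun n i => fwd sigma d (V n) x k i * V n (S k) i j)
           (fun i => fwd sigma d W x k i * W (S k) i j)).
  intros i Hi. apply is_lim_seq_mult'; [apply IH; [lia|exact Hi]|].
  now apply H.
Qed.

Lemma is_lim_seq_cost d (V : nat -> nat -> nat -> nat -> R) (W : nat -> nat -> nat -> R) :
  d L = dL ->
  (forall k i j, (k < L)%nat -> (i < d k)%nat -> (j < d (S k))%nat ->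
     is_lim_seq (fun n => V n (S k) i j) (W (S k) i j)) ->
  is_lim_seq (fun n => cost d (V n)) (cost d W).
Proof.
  intros Hd H. unfold cost. apply is_lim_seq_plus'.
  - apply (is_lim_seq_mean D (fun n xy => e (net L sigma d (V n) (fst xy)) (snd xy))
             (fun xy => e (net L sigma d W (fst xy)) (snd xy))).
    intros xy _. apply is_lim_seq_error; [intros; now apply net_is_vec|now apply net_is_vec|].
    intros j Hj. unfold net. rewrite Hd. destruct (Nat.ltb_spec j dL); [|lia].
    apply is_lim_seq_fwd; [exact H|lia|lia].
  - apply is_lim_seq_mult'; [apply is_lim_seq_const|].
    apply (is_lim_seq_sumR L (fun n k => lpen p b (d k) (d (S k)) (V n (S k)))
             (fun k => lpen p b (d k) (d (S k)) (W (S k)))).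
    intros k Hk. apply (is_lim_seq_lpen p Hp b (d k) (d (S k)) (fun n => V n (S k))). auto.
Qed.

(** The finitely many entries that matter at widths [d]; the first component [k] stands for the
    matrix [W (S k)]. *)
Definition coordinates (d : nat -> nat) : list (nat * (nat * nat)) :=
  flat_map (fun k => map (pair k) (list_prod (seq 0 (d k)) (seq 0 (d (S k))))) (seq 0 L).

Lemma in_coordinates d k i j :
  In (k, (i, j)) (coordinates d) <-> (k < L)%nat /\ (i < d k)%nat /\ (j < d (S k))%nat.
Proof.
  unfold coordinates. rewrite in_flat_map. split.
  - intros [q [Hq Hin]]. apply in_map_iff in Hin. destruct Hin as [ij [Heq Hij]].
    injection Heq as -> ->. apply in_prod_iff in Hij. rewrite !in_seq in *. lia.
  - intros [Hk [Hi Hj]]. exists k. split; [apply in_seq; lia|].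
    apply in_map_iff. exists (i, j). split; [reflexivity|].
    apply in_prod_iff. rewrite !in_seq. lia.
Qed.

Lemma minimiser_exists d : d L = dL -> exists W, minimiser d W.
Proof.
  intros Hd.
  (* [completeness] provides suprema, so the infimum is taken through negated costs. *)
  destruct (completeness (fun r => exists W, r = - cost d W)) as [m' [Hub Hlub]].
  { exists 0. intros r [W ->]. pose proof (cost_nonneg d W Hd). lra. }
  { now exists (- cost d (fun _ _ _ => 0)), (fun _ _ _ => 0). }
  set (m := - m').
  assert (Hm : forall W, m <= cost d W).
  { intros W. enough (- cost d W <= m') by (unfold m; lra). apply Hub. now exists W. }
  assert (Hseq : forall n, exists W, cost d W <= m + / (INR n + 1)).
  { intros n. apply NNPP. intros Hno.
    assert (Hpos : 0 < / (INR n + 1))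
      by (apply Rinv_0_lt_compat; pose proof (pos_INR n); lra).
    enough (m' <= m' - / (INR n + 1)) by lra.
    apply Hlub. intros r [W ->]. apply Rnot_lt_le. intros Hlt. apply Hno. exists W.
    unfold m. lra. }
  apply functional_choice in Hseq. destruct Hseq as [V HV].
  (* Costs along the minimising sequence are at most [m + 1], and an entry is at most its layer
     penalty. *)
  destruct (bounded_family_subseq (coordinates d)
    (fun n a => V n (S (fst a)) (fst (snd a)) (snd (snd a))) ((m + 1) / lam))
    as [phi [Hphi Hlim]].
  { intros n [k [i j]] Hin. apply in_coordinates in Hin. destruct Hin as [Hk [Hi Hj]]. simpl.
    eapply Rle_trans; [apply (entry_le_lpen p Hp b (d k) (d (S k)) (V n (S k))); assumption|].
    apply lpen_le_cost; [exact Hd| |exact Hk].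
    eapply Rle_trans; [apply HV|]. apply Rplus_le_compat_l.
    rewrite <- Rinv_1. apply Rinv_le_contravar; [lra|]. pose proof (pos_INR n). lra. }
  (* [Lim_seq] is total; entries outside the widths get some value that the cost never reads. *)
  set (W := fun q i j => real (Lim_seq (fun n => V (phi n) q i j))).
  exists W. intros W'. apply Rle_trans with m; [|apply Hm].
  assert (Hcost : is_lim_seq (fun n => cost d (V (phi n))) (cost d W)).
  { apply (is_lim_seq_cost d (fun n => V (phi n))); [exact Hd|]. intros k i j Hk Hi Hj.
    apply (Lim_seq_correct' (fun n => V (phi n) (S k) i j)).
    apply (Hlim (k, (i, j))). now apply in_coordinates. }
  apply (is_lim_seq_le (fun n => cost d (V (phi n))) (fun n => m + / (INR (phi n) + 1))
           (cost d W) m); [intros; apply HV|exact Hcost|].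
  replace (Finite m) with (Finite (m + 0)) by (f_equal; ring).
  apply is_lim_seq_plus'; [apply is_lim_seq_const|].
  apply (is_lim_seq_subseq (fun n => / (INR n + 1))); [exact Hphi|apply is_lim_seq_inv_S].
Qed.

(** * Changing the widths *)

(** [W] may hold arbitrary values outside its widths, so enlarging them requires zeroing these
    entries first. *)
Definition pad (d : nat -> nat) (W : nat -> nat -> nat -> R) : nat -> nat -> nat -> R :=
  fun q i m => if (Nat.ltb i (d (pred q)) && Nat.ltb m (d q))%bool then W q i m else 0.

(** Added units have zero incoming weights, so [sigma0] makes their output 0. *)
Lemma fwd_pad d d' W x q :
  d 0%nat = d' 0%nat -> (forall q, (q <= L)%nat -> (d q <= d' q)%nat) -> (q <= L)%nat ->
  forall i, (i < d' q)%nat ->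
    fwd sigma d' (pad d W) x q i = if Nat.ltb i (d q) then fwd sigma d W x q i else 0.
Proof.
  intros Hd0 Hle. induction q as [|q IH]; intros Hq i Hi.
  - destruct (Nat.ltb_spec i (d 0%nat)); [reflexivity|lia].
  - simpl. rewrite (sumR_pad (d q) (d' q)).
    + destruct (Nat.ltb_spec i (d (S q))) as [Hlt|Hge].
      * f_equal. apply sumR_ext. intros k Hk.
        rewrite IH by (try lia; specialize (Hle q ltac:(lia)); lia).
        unfold pad. simpl.
        destruct (Nat.ltb_spec k (d q)); [|lia].
        destruct (Nat.ltb_spec i (d (S q))); [reflexivity|lia].
      * rewrite sumR_eq0; [apply sigma0; lia|]. intros k Hk. unfold pad.
        destruct (Nat.ltb_spec i (d (S q))); [lia|].
        rewrite Bool.andb_false_r. ring.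
    + apply Hle. lia.
    + intros k Hk. unfold pad. simpl. destruct (Nat.ltb_spec k (d q)); [lia|]. simpl. ring.
Qed.

Lemma cost_pad d d' W :
  d 0%nat = d' 0%nat -> d L = d' L -> (forall q, (q <= L)%nat -> (d q <= d' q)%nat) ->
  cost d' (pad d W) = cost d W.
Proof.
  intros Hd0 HdL Hle. unfold cost. f_equal.
  - apply mean_ext. intros xy _. f_equal. apply net_ext; [exact HdL|].
    intros j Hj. rewrite fwd_pad by (auto; lia).
    destruct (Nat.ltb_spec j (d L)); [reflexivity|lia].
  - f_equal. apply sumR_ext. intros k Hk.
    rewrite (lpen_pad p b (d k) (d (S k))).
    + apply lpen_ext. intros i j Hi Hj. unfold pad. simpl.
      destruct (Nat.ltb_spec i (d k)); [|lia].
      destruct (Nat.ltb_spec j (d (S k))); [reflexivity|lia].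
    + apply Hle. lia.
    + apply Hle. lia.
    + intros i j Hij. unfold pad. simpl.
      destruct (Nat.ltb_spec i (d k)); [|reflexivity].
      destruct (Nat.ltb_spec j (d (S k))); [lia|reflexivity].
Qed.

(** Translates an index valid after deleting unit [j] of layer [l] into the one before. *)
Definition old_index (l j q i : nat) : nat := if Nat.eqb q l then skip j i else i.

Definition remove_width (l : nat) (d : nat -> nat) : nat -> nat :=
  fun q => if Nat.eqb q l then pred (d q) else d q.

Definition remove_unit (l j : nat) (W : nat -> nat -> nat -> R) : nat -> nat -> nat -> R :=
  fun q i m => W q (old_index l j (pred q) i) (old_index l j q m).

Lemma old_index_lt l j d q i :
  (j < d l)%nat -> (i < remove_width l d q)%nat -> (old_index l j q i < d q)%nat.
Proof.
  unfold old_index, remove_width. destruct (Nat.eqb_spec q l) as [->|]; [|lia].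
  intros Hj Hi. destruct (d l) as [|n]; [lia|]. now apply skip_lt.
Qed.

(** The unit acts on the next layer only through its output times its outgoing weights. Asking for
    this product to vanish covers both a silent unit (fan-in) and an unread one (fan-out). *)
Lemma fwd_remove l j d W x :
  (j < d l)%nat ->
  (forall m, (l < L)%nat -> (m < d (S l))%nat -> fwd sigma d W x l j * W (S l) j m = 0) ->
  forall q i, l <> 0%nat -> (q <= L)%nat -> (i < remove_width l d q)%nat ->
    fwd sigma (remove_width l d) (remove_unit l j W) x q i
    = fwd sigma d W x q (old_index l j q i).
Proof.
  intros Hj Hdead q. induction q as [|q IH]; intros i Hl Hq Hi.
  - unfold old_index. destruct l; [lia|reflexivity].
  - simpl. f_equal.
    rewrite (sumR_ext (remove_width l d q) _ (fun k =>
      fwd sigma d W x q (old_index l j q k)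
      * W (S q) (old_index l j q k) (old_index l j (S q) i))).
    + pose proof (old_index_lt l j d (S q) i Hj Hi) as Hlt.
      set (m := old_index l j (S q) i) in *. clearbody m.
      unfold remove_width, old_index.
      destruct (Nat.eqb_spec q l) as [->|]; [|reflexivity].
      specialize (Hdead m ltac:(lia) Hlt).
      destruct (d l) as [|n]; [lia|]. simpl pred.
      rewrite (sumR_skip n j (fun k => fwd sigma d W x l k * W (S l) k m)) by exact Hj.
      rewrite Hdead. ring.
    + intros k Hk. rewrite IH by (auto; lia). reflexivity.
Qed.

(** Deletion takes a column from the matrix of layer [l] and a row from the next; neither raises a
    penalty. *)
Lemma lpen_remove_le l j d W q :
  (j < d l)%nat ->
  lpen p b (remove_width l d q) (remove_width l d (S q)) (remove_unit l j W (S q))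
  <= lpen p b (d q) (d (S q)) (W (S q)).
Proof.
  intros Hj. unfold remove_width, remove_unit, old_index. simpl pred.
  destruct (Nat.eqb_spec q l) as [->|Hq].
  - destruct (Nat.eqb_spec (S l) l) as [|_]; [lia|].
    destruct (d l) as [|n]; [lia|]. simpl.
    now apply (lpen_skip_row_le p Hp b n (d (S l)) (W (S l))).
  - destruct (Nat.eqb_spec (S q) l) as [<-|_]; [|apply Rle_refl].
    destruct (d (S q)) as [|n]; [lia|]. simpl.
    now apply (lpen_skip_col_le p Hp b (d q) n (W (S q))).
Qed.

Lemma unit_pen_eq0_dead d W x k j m :
  (S k < L)%nat -> (m < d (S (S k)))%nat -> unit_pen d W k j = 0 ->
  fwd sigma d W x (S k) j * W (S (S k)) j m = 0.
Proof.
  intros Hk Hm. unfold unit_pen. destruct b; intros H0.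
  - rewrite fwd_S. unfold pre. rewrite sumR_eq0; [rewrite sigma0 by lia; ring|].
    intros i Hi. pose proof (entry_le_pnorm p Hp (d k) (fun i => W (S k) i j) i Hi) as Hle.
    simpl in Hle. rewrite H0 in Hle.
    assert (Hz : W (S k) i j = 0).
    { apply Rabs_eq_0. pose proof (Rabs_pos (W (S k) i j)). lra. }
    rewrite Hz. ring.
  - pose proof (entry_le_pnorm p Hp (d (S (S k))) (fun m => W (S (S k)) j m) m Hm) as Hle.
    simpl in Hle. rewrite H0 in Hle.
    assert (Hz : W (S (S k)) j m = 0).
    { apply Rabs_eq_0. pose proof (Rabs_pos (W (S (S k)) j m)). lra. }
    rewrite Hz. ring.
Qed.

Lemma cost_remove_le d W k j :
  (S k < L)%nat -> (j < d (S k))%nat -> unit_pen d W k j = 0 ->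
  cost (remove_width (S k) d) (remove_unit (S k) j W) <= cost d W.
Proof.
  intros Hk Hj H0. unfold cost. apply Rplus_le_compat.
  - right. apply mean_ext. intros xy _. f_equal. apply net_ext.
    + unfold remove_width. destruct (Nat.eqb_spec L (S k)); [lia|reflexivity].
    + intros i Hi. rewrite fwd_remove.
      * unfold old_index. destruct (Nat.eqb_spec L (S k)); [lia|reflexivity].
      * exact Hj.
      * intros m _ Hm. now apply unit_pen_eq0_dead.
      * lia.
      * lia.
      * unfold remove_width. destruct (Nat.eqb_spec L (S k)); [lia|exact Hi].
  - apply Rmult_le_compat_l; [lra|]. apply sumR_le. intros q _. now apply lpen_remove_le.
Qed.

(** * The width bound *)

(** The bound of [colpen_count] rounded up, and at least 1 so that widths stay admissible. *)
Definition width_bound (B c : R) (N : nat) : nat :=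
  Nat.max 1 (Z.to_nat (up (INR N * rpow B p / rpow (c / (INR N + 1)) p))).

(* Widths are controlled layer by layer from the fixed end on which the
   unpenalised side of a unit lies: the output for fan-in, the input for fan-out. *)
Definition neighbour (k : nat) : nat := if b then S (S k) else k.

(** Otherwise every unit has unpenalised side at least [c], and [colpen_count] on the matrix facing
    the neighbour (outgoing for fan-in, incoming and transposed for fan-out) bounds the width. *)
Lemma wide_layer_has_dead_unit B c d W k N :
  0 < c -> (S k < L)%nat ->
  (forall k, (k < L)%nat -> lpen p b (d k) (d (S k)) (W (S k)) <= B) ->
  (forall j, (j < d (S k))%nat -> unit_pen d W k j = 0 \/ c <= unit_other d W k j) ->
  (d (neighbour k) <= N)%nat -> (width_bound B c N < d (S k))%nat ->
  exists j, (j < d (S k))%nat /\ unit_pen d W k j = 0.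
Proof.
  intros Hc Hk HB Halt HN Hwide. apply NNPP. intros Hno.
  assert (Hall : forall j, (j < d (S k))%nat -> c <= unit_other d W k j).
  { intros j Hj. destruct (Halt j Hj) as [H0|]; [|assumption].
    exfalso. apply Hno. now exists j. }
  assert (Hcount : INR (d (S k)) <= INR N * rpow B p / rpow (c / (INR N + 1)) p).
  { clear Halt Hno Hwide. unfold unit_other, neighbour in *. destruct b.
    - exact (colpen_count p Hp (d (S k)) (d (S (S k))) N (W (S (S k))) B c
               HN Hc (HB (S k) Hk) Hall).
    - exact (colpen_count p Hp (d (S k)) (d k) N (fun i j => W (S k) j i) B c
               HN Hc (HB k ltac:(lia)) Hall). }
  unfold width_bound in Hwide.
  set (r := INR N * rpow B p / rpow (c / (INR N + 1)) p) in *.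
  destruct (archimed r) as [Hup _].
  assert (Hlt : (Z.of_nat (d (S k)) < up r)%Z).
  { apply lt_IZR. rewrite <- INR_IZR_INZ. lra. }
  lia.
Qed.

Lemma width_bound_dominates (h : nat -> nat) d :
  d 0%nat = h 0%nat -> d L = h L ->
  (forall k, (S k < L)%nat -> (d (neighbour k) <= h (neighbour k))%nat ->
     (d (S k) <= h (S k))%nat) ->
  forall q, (q <= L)%nat -> (d q <= h q)%nat.
Proof.
  intros Hd0 HdL Hstep. unfold neighbour in Hstep. destruct b.
  (* Fan-in: induction on the distance [r] from the output. *)
  - enough (H : forall r, (r <= L)%nat -> (d (L - r) <= h (L - r))%nat).
    { intros q Hq. replace q with (L - (L - q))%nat by lia. apply H. lia. }
    induction r as [|r IH]; intros Hr; [rewrite Nat.sub_0_r; lia|].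
    destruct (Nat.eq_dec (S r) L) as [Heq|Hne].
    { replace (L - S r)%nat with 0%nat by lia. lia. }
    destruct r as [|r'] eqn:Hr'.
    + replace (L - 1)%nat with (S (L - 2)) by lia. apply Hstep; [lia|].
      replace (S (S (L - 2))) with L by lia. lia.
    + replace (L - S (S r'))%nat with (S (L - S (S (S r')))) by lia. apply Hstep; [lia|].
      replace (S (S (L - S (S (S r'))))) with (L - S r')%nat by lia. apply IH. lia.
  - induction q as [|q IH]; intros Hq; [lia|].
    destruct (Nat.eq_dec (S q) L) as [->|Hne]; [lia|].
    apply Hstep; [lia|apply IH; lia].
Qed.

(** Hidden widths iterate [width_bound] once per step away from the fixed end where [neighbour]
    leads. *)
Definition widths (B c : R) (q : nat) : nat :=
  if Nat.eqb q 0 then d0 else if Nat.eqb q L then dL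
  else if b then Nat.iter (L - q) (width_bound B c) dL else Nat.iter q (width_bound B c) d0.

Lemma widths_S B c k :
  (S k < L)%nat -> widths B c (S k) = width_bound B c (widths B c (neighbour k)).
Proof.
  intros Hk. unfold widths, neighbour.
  destruct (Nat.eqb_spec (S k) 0) as [|_]; [lia|].
  destruct (Nat.eqb_spec (S k) L) as [|_]; [lia|]. destruct b.
  - replace (L - S k)%nat with (S (L - S (S k))) by lia. simpl Nat.iter.
    destruct (Nat.eqb_spec (S (S k)) 0) as [|_]; [lia|].
    destruct (Nat.eqb_spec (S (S k)) L) as [<-|_]; [|reflexivity].
    now rewrite Nat.sub_diag.
  - simpl Nat.iter. destruct (Nat.eqb_spec k 0) as [->|_]; [reflexivity|].
    destruct (Nat.eqb_spec k L) as [|_]; [lia|reflexivity].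
Qed.

Lemma widths_admissible B c : admissible L d0 dL (widths B c).
Proof.
  split; [reflexivity|]. split.
  - unfold widths. rewrite Nat.eqb_refl. destruct (Nat.eqb_spec L 0); [lia|reflexivity].
  - intros [|k] Hk; [lia|]. rewrite widths_S by lia. unfold width_bound. lia.
Qed.

(** Strong induction on a bound [n] for the total width. While some layer exceeds [dstar] and its
    neighbour does not, a unit can be deleted; once there is none, every width is at most that of
    [dstar] and padding applies. *)
Theorem cost_attains_minimum :
  exists dstar Wstar, admissible L d0 dL dstar /\
    forall d W, admissible L d0 dL d -> cost dstar Wstar <= cost d W.
Proof.
  destruct minimiser_unit_alternative as [B [c [HB [Hc Hunit]]]].
  set (dstar := widths B c).
  pose proof (widths_admissible B c) as Hstar. fold dstar in Hstar.
  destruct Hstar as [Hs0 [HsL Hspos]].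
  destruct (minimiser_exists dstar HsL) as [Wstar HWstar].
  exists dstar, Wstar. split; [now repeat split|].
  enough (Hind : forall n d W, admissible L d0 dL d -> sumR L (fun q => INR (d q)) <= INR n ->
            cost dstar Wstar <= cost d W).
  { intros d W Hd. destruct (INR_unbounded (sumR L (fun q => INR (d q)))) as [n Hn].
    apply (Hind n); [exact Hd|lra]. }
  induction n as [n IH] using lt_wf_ind. intros d W [Hd0 [HdL Hpos]] Hsum.
  destruct (classic (exists k, (S k < L)%nat /\
      (d (neighbour k) <= dstar (neighbour k))%nat /\ (dstar (S k) < d (S k))%nat))
    as [[k [Hk [Hnb Hwide]]]|Hno].
  (* Dead units are guaranteed at minimisers, so [W] is first replaced by one of the same widths. *)
  - destruct (minimiser_exists d HdL) as [V HV].
    destruct (Hunit d V Hd0 HdL HV) as [HVB Halt].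
    destruct (wide_layer_has_dead_unit B c d V k (dstar (neighbour k)) Hc Hk HVB
      (fun j => Halt k j Hk) Hnb) as [j [Hj H0]].
    { unfold dstar in *. now rewrite <- widths_S. }
    (* Since [dstar (S k)] is at least 1 and below [d (S k)], the layer keeps a unit after the
       deletion. *)
    pose proof (Hspos (S k) ltac:(lia)) as Hs.
    assert (Hsum' : sumR L (fun q => INR (remove_width (S k) d q))
                    = sumR L (fun q => INR (d q)) - 1).
    { rewrite (sumR_update L (S k) _ (fun q => INR (d q)) Hk).
      - unfold remove_width. rewrite Nat.eqb_refl.
        destruct (d (S k)) as [|w]; [lia|]. rewrite S_INR. simpl pred. ring.
      - intros q _ Hq. unfold remove_width. destruct (Nat.eqb_spec q (S k)); [lia|reflexivity]. }
    assert (Hn : (0 < n)%nat).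
    { apply INR_lt. simpl (INR 0).
      assert (Hge : 0 <= sumR L (fun q => INR (remove_width (S k) d q)))
        by (apply sumR_nonneg; intros; apply pos_INR). lra. }
    apply Rle_trans with (cost (remove_width (S k) d) (remove_unit (S k) j V)).
    + apply (IH (pred n)); [lia| |].
      * unfold remove_width. split; [exact Hd0|]. split.
        -- destruct (Nat.eqb_spec L (S k)); [lia|exact HdL].
        -- intros l Hl. destruct (Nat.eqb_spec l (S k)) as [->|]; [lia|now apply Hpos].
      * rewrite Hsum'. destruct n as [|n']; [lia|]. rewrite S_INR in Hsum. simpl pred. lra.
    + eapply Rle_trans; [now apply cost_remove_le|apply HV].
  - rewrite <- (cost_pad d dstar W).
    + apply HWstar.
    + congruence.
    + congruence.
    + apply width_bound_dominates; [congruence|congruence|].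
      intros k Hk Hnb. apply Nat.nlt_ge. intros Hlt. apply Hno. now exists k.
Qed.

End Network.

(** * From the standing assumptions to the hypotheses of the section *)

Theorem theorem1
  (L d0 dL : nat) (HL : (0 < L)%nat) (Hd0 : (0 < d0)%nat) (HdL : (0 < dL)%nat)
  (Y : Type) (D : list ((nat -> R) * Y))
  (sigma : nat -> R -> R) (e : (nat -> R) -> Y -> R)
  (lam p : R) (Hlam : 0 < lam) (Hp : 1 <= p)
  (Omega : (nat -> nat) -> (nat -> nat -> nat -> R) -> R)
  (HOmega : Omega = (fun d W => Omega_in L d W lam p) \/
            Omega = (fun d W => Omega_out L d W lam p))
  (* (i) *)
  (Hs1 : forall l, (1 <= l <= L)%nat ->
     exists b1 : R -> R, (forall S, 0 <= S -> 0 <= b1 S) /\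
       forall S s, 0 <= S -> Rabs s <= S -> Rabs (sigma l s) <= b1 S * Rabs s)
  (* (ii) *)
  (Hs2 : forall l, (1 <= l <= L)%nat -> forall s,
     (exists dl, left_deriv (sigma l) s dl) /\ (exists dr, right_deriv (sigma l) s dr))
  (* (iii) *)
  (Hs3 : forall l, (1 <= l <= L)%nat ->
     exists b2 : R -> R, (forall S, 0 <= S -> 0 <= b2 S) /\
       forall S s, 0 <= S -> Rabs s <= S ->
         (forall dl, left_deriv (sigma l) s dl -> Rabs dl <= b2 S) /\
         (forall dr, right_deriv (sigma l) s dr -> Rabs dr <= b2 S))
  (* assumptions on e, on R^{dL} (zero-padded vectors) *)
  (He1 : forall v y, is_vec dL v -> 0 <= e v y)
  (He2 : forall v y, is_vec dL v -> exists g, is_grad dL (fun w => e w y) v g)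
  (He3 : exists b3 : R -> R, (forall S, 0 <= S -> 0 <= b3 S) /\
     forall S v y g, 0 <= S -> is_vec dL v -> e v y <= S ->
       is_grad dL (fun w => e w y) v g ->
       forall i, (i < dL)%nat -> Rabs (g i) <= b3 S) :
  exists (dstar : nat -> nat) (Wstar : nat -> nat -> nat -> R),
    admissible L d0 dL dstar /\
    forall (d : nat -> nat) (W : nat -> nat -> nat -> R),
      admissible L d0 dL d ->
      objective L D sigma e Omega dstar Wstar <= objective L D sigma e Omega d W.
Proof.
  (* Assumption (i) at [S = 0], [s = 0]. *)
  assert (sigma0 : forall l, (1 <= l <= L)%nat -> sigma l 0 = 0).
  { intros l Hl. destruct (Hs1 l Hl) as [b1 [_ H]]. apply Rabs_eq_0.
    specialize (H 0 0 (Rle_refl 0)). rewrite Rabs_R0, Rmult_0_r in H.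
    pose proof (Rabs_pos (sigma l 0)). specialize (H (Rle_refl 0)). lra. }
  assert (sigma_lip : forall l, (1 <= l <= L)%nat -> loc_lipschitz (sigma l)).
  { intros l Hl. destruct (Hs3 l Hl) as [b2 [Hb2 H]].
    now apply (one_sided_deriv_loc_lipschitz (sigma l) b2 (Hs2 l Hl)). }
  assert (e_lip : forall S, 0 <= S -> exists G, 0 <= G /\
    forall v y, is_vec dL v -> e v y <= S -> exists delta, 0 < delta /\
      forall w, is_vec dL w -> supnorm dL (fun i => w i - v i) < delta ->
        Rabs (e w y - e v y) <= G * supnorm dL (fun i => w i - v i)).
  { destruct He3 as [b3 [Hb3 H]]. intros S HS. exists (INR dL * b3 S + 1). split.
    - pose proof (Rmult_le_pos _ _ (pos_INR dL) (Hb3 S HS)). lra.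
    - intros v y Hv HvS. destruct (He2 v y Hv) as [g Hg].
      apply (is_grad_local_bound dL (fun w => e w y) v g (b3 S) Hv Hg).
      now apply (H S v y g HS Hv HvS). }
  (* For either penalty, [objective] unfolds to [cost] with the matching flag. *)
  destruct HOmega as [-> | ->].
  - exact (cost_attains_minimum L d0 dL D sigma e lam p true
             HL Hlam Hp sigma0 sigma_lip He1 e_lip).
  - exact (cost_attains_minimum L d0 dL D sigma e lam p false
             HL Hlam Hp sigma0 sigma_lip He1 e_lip).
Qed.
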